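(* Let $(X,d)$ be a locally compact, geodesically complete CAT(0)-space connected at infinity, and let $d'$ be a metric on $X$ such that $(X,d')$ is a locally compact geodesically complete CAT(0)-space and $d(x,y)\le1\iff d'(x,y)\le1$ for all $x,y\in X$. Let $c\colon(-\infty,+\infty)\to X$ be a complete geodesic of $(X,d)$ which bounds a flat strip in $(X,d)$. Then $c$ is a geodesic bounding a flat strip with respect to $d'$ as well, and $d'(c(t_1),c(t_2))=d(c(t_1),c(t_2))$ for all $t_1,t_2\in\mathbb R$.
   Context: A flat strip is a subset isometric to a strip $\mathbb R\times[0,w]$, $w>0$, in the Euclidean plane; a complete geodesic bounds a flat strip if it is one of the two boundary lines of such a subset. Geodesically complete: geodesic and every geodesic segment lies in a complete geodesic; connected at infinity: complement of every metric ball path connected. *)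

(* Defs.v *)
From Stdlib Require Import Reals List.
Open Scope R_scope.
Set Implicit Arguments.

Section Defs.
Variable X : Type.

Definition is_metric (d : X -> X -> R) : Prop :=
  (forall x y, 0 <= d x y) /\ (forall x y, d x y = 0 <-> x = y) /\
  (forall x y, d x y = d y x) /\ (forall x y z, d x z <= d x y + d y z).

Definition geod_segment (d : X -> X -> R) (c : R -> X) (a b : R) : Prop :=
  a <= b /\ forall s t, a <= s <= b -> a <= t <= b -> d (c s) (c t) = Rabs (s - t).

Definition complete_geodesic (d : X -> X -> R) (c : R -> X) : Prop :=
  forall s t, d (c s) (c t) = Rabs (s - t).

Definition geodesic_space (d : X -> X -> R) : Prop :=
  forall x y, exists c, geod_segment d c 0 (d x y) /\ c 0 = x /\ c (d x y) = y.

Definition geodesically_complete (d : X -> X -> R) : Prop :=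
  geodesic_space d /\
  forall c a b, a < b -> geod_segment d c a b ->
    exists c', complete_geodesic d c' /\ forall t, a <= t <= b -> c' t = c t.

End Defs.

Definition dE (p q : R * R) : R :=
  sqrt ((fst p - fst q) ^ 2 + (snd p - snd q) ^ 2).

Definition interp (A B : R * R) (L s : R) : R * R :=
  (fst A + s / L * (fst B - fst A), snd A + s / L * (snd B - snd A)).

Section Defs2.
Variable X : Type.

Definition CAT0 (d : X -> X -> R) : Prop :=
  is_metric d /\ geodesic_space d /\
  forall (x y z : X) (cxy cyz czx : R -> X) (A B C : R * R),
    geod_segment d cxy 0 (d x y) -> cxy 0 = x -> cxy (d x y) = y ->
    geod_segment d cyz 0 (d y z) -> cyz 0 = y -> cyz (d y z) = z ->
    geod_segment d czx 0 (d z x) -> czx 0 = z -> czx (d z x) = x ->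
    dE A B = d x y -> dE B C = d y z -> dE C A = d z x ->
    let sides := (cxy, d x y, A, B) :: (cyz, d y z, B, C) :: (czx, d z x, C, A) :: nil in
    forall c1 L1 A1 B1 c2 L2 A2 B2,
      In (c1, L1, A1, B1) sides -> In (c2, L2, A2, B2) sides ->
      forall u v, 0 <= u <= L1 -> 0 <= v <= L2 ->
        d (c1 u) (c2 v) <= dE (interp A1 B1 L1 u) (interp A2 B2 L2 v).

Definition open_set (d : X -> X -> R) (U : X -> Prop) : Prop :=
  forall x, U x -> exists r, 0 < r /\ forall y, d x y < r -> U y.

Definition compact_set (d : X -> X -> R) (K : X -> Prop) : Prop :=
  forall (I : Type) (U : I -> X -> Prop),
    (forall i, open_set d (U i)) -> (forall x, K x -> exists i, U i x) ->
    exists l : list I, forall x, K x -> exists i, In i l /\ U i x.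

Definition locally_compact (d : X -> X -> R) : Prop :=
  forall x, exists K, compact_set d K /\
    exists r, 0 < r /\ forall y, d x y < r -> K y.

Definition path_connected (d : X -> X -> R) (S : X -> Prop) : Prop :=
  forall a b, S a -> S b ->
    exists p : R -> X, p 0 = a /\ p 1 = b /\
      (forall t, 0 <= t <= 1 -> S (p t)) /\
      (forall t, 0 <= t <= 1 -> forall eps, 0 < eps ->
         exists del, 0 < del /\ forall t', 0 <= t' <= 1 -> Rabs (t' - t) < del ->
           d (p t) (p t') < eps).

Definition connected_at_infinity (d : X -> X -> R) : Prop :=
  forall x r, path_connected d (fun y => ~ d x y < r).

Definition bounds_flat_strip (d : X -> X -> R) (c : R -> X) : Prop :=
  exists (w : R) (f : R * R -> X), 0 < w /\
    (forall p q, 0 <= snd p <= w -> 0 <= snd q <= w -> d (f p) (f q) = dE p q) /\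
    ((forall y, (exists t, c t = y) <-> (exists s, f (s, 0) = y)) \/
     (forall y, (exists t, c t = y) <-> (exists s, f (s, w) = y))).

End Defs2.

(* Main.v *)
Require Import Defs.
From Stdlib Require Import Reals List.
Open Scope R_scope.
From Stdlib Require Import Lra Lia ZArith.
Set Implicit Arguments.

(** A point at distance 1 from the start of a [d]-segment of integer length [n >= 2]
    is determined by unit balls, so [d = n] implies [d' = n]. Hence the points
    [S (t + i, x)], [i] an integer, of each line of the strip [S] lie on a
    [d']-geodesic line, and all these lines are parallel. By the CN and four-point
    inequalities two of them span a Euclidean strip, so
    [d' (p, q)^2 = sep (p, q)^2 + (H q - H p)^2] with [sep] a pseudometric and [H]
    additive. If [(x' - x)^2 = s (2 N - s)], then [S (t + s, x')] and [S (t + N, x)]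
    are at distance [N], which gives
    [sep ((t, x), (t + s, x'))^2 = k (2 N - k)] with [k = H (t + s) - H t].
    Letting [N] tend to infinity, [H] is differentiable and its derivative at [t] is
    the squared scale factor of the cross-section at time [t]; the triangle
    inequality for [sep] gives [k >= s H'(t + s) - O(s^3)]. This forces
    [H'(t + s) <= H'(t) + O(s^2)], so [H'] is decreasing, and being periodic it is
    constant, equal to 1. Now [S (t + s, x)] is the midpoint of two points that
    realise equality in the CN inequality with [S (t, x)], so [sep] does not depend
    on time and [d' = d] on the strip. *)

(** * Comparison inequalities and transfer of integer distances *)

Lemma sqrt_eq_of_sq (x y : R) : 0 <= y -> x = y ^ 2 -> sqrt x = y.
Proof. now intros hy ->; apply sqrt_pow2. Qed.

Section CN.
Variables (X : Type) (m : X -> X -> R).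

Definition midpoint (y z p : X) : Prop :=
  m y p = m y z / 2 /\ m p z = m y z / 2.

(** The Bruhat-Tits inequality: a median is no longer than in the Euclidean triangle with the same
    sides. *)
Definition cn_inequality : Prop :=
  forall x y z p, midpoint y z p ->
    m x p ^ 2 <= m x y ^ 2 / 2 + m x z ^ 2 / 2 - m y z ^ 2 / 4.

Definition has_midpoints : Prop := forall y z, exists p, midpoint y z p.

(** The base lies on the first axis and the law of cosines gives the abscissa [u] of the apex. The
    triangle inequalities yield [u ^ 2 <= a ^ 2], so the ordinate exists. The last equation is the
    Euclidean median formula. *)
Lemma comparison_triangle (a b L : R) :
  0 <= a -> 0 <= b -> 0 < L -> L <= a + b -> a <= L + b -> b <= a + L ->
  exists A B C : R * R, dE A B = a /\ dE B C = L /\ dE C A = b /\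
    dE (interp B C L (L / 2)) A ^ 2 = a ^ 2 / 2 + b ^ 2 / 2 - L ^ 2 / 4.
Proof.
intros ha hb hL h1 h2 h3.
set (u := (a ^ 2 + L ^ 2 - b ^ 2) / (2 * L)).
assert (hu : 2 * L * u = a ^ 2 + L ^ 2 - b ^ 2) by (unfold u; field; lra).
assert (hua : u ^ 2 <= a ^ 2).
{ assert (u <= a) by (apply (Rmult_le_reg_l (2 * L)); nra).
  assert (- a <= u) by (apply (Rmult_le_reg_l (2 * L)); nra).
  nra. }
set (v := sqrt (a ^ 2 - u ^ 2)).
assert (hv : v ^ 2 = a ^ 2 - u ^ 2) by (unfold v; apply pow2_sqrt; lra).
exists (u, v), (0, 0), (L, 0); unfold dE, interp; simpl fst; simpl snd.
repeat split.
- apply sqrt_eq_of_sq; [lra | ring_simplify; nra].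
- apply sqrt_eq_of_sq; [lra | ring_simplify; nra].
- apply sqrt_eq_of_sq; [lra | ring_simplify; nra].
- rewrite pow2_sqrt by (apply Rplus_le_le_0_compat; apply pow2_ge_0).
  replace (L / 2 / L) with (1 / 2) by (field; lra); nra.
Qed.

Lemma CAT0_geodesic_midpoint (hX : CAT0 m) (y z : X) :
  exists p, midpoint y z p /\
    forall x, m x p ^ 2 <= m x y ^ 2 / 2 + m x z ^ 2 / 2 - m y z ^ 2 / 4.
Proof.
destruct hX as [[hpos [hzero [hsym htri]]] [hgeo hcat]].
destruct (hgeo y z) as [cyz [hyz [yz0 yz1]]].
assert (hL := hpos y z).
assert (hmid : midpoint y z (cyz (m y z / 2))).
{ destruct hyz as [_ hyz]; split.
  - rewrite <- yz0 at 1; rewrite hyz by lra.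
    rewrite Rabs_left1; lra.
  - rewrite <- yz1 at 2; rewrite hyz by lra.
    rewrite Rabs_left1; lra. }
exists (cyz (m y z / 2)); split; [exact hmid |]; intro x.
destruct hL as [hL | hL].
- destruct (hgeo x y) as [cxy [hxy [xy0 xy1]]].
  destruct (hgeo z x) as [czx [hzx [zx0 zx1]]].
  destruct (@comparison_triangle (m x y) (m z x) (m y z))
    as [A [B [C [hAB [hBC [hCA hE]]]]]]; auto.
  + pose proof (htri y x z); pose proof (hsym y x); pose proof (hsym x z); lra.
  + pose proof (htri x z y); pose proof (hsym z y); pose proof (hsym x z); lra.
  + pose proof (htri z y x); pose proof (hsym z y); pose proof (hsym y x); lra.
  + pose proof (hcat x y z cxy cyz czx A B C hxy xy0 xy1 hyz yz0 yz1 hzx zx0 zx1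
      hAB hBC hCA) as H; cbv zeta in H.
    specialize (H cyz (m y z) B C cxy (m x y) A B (or_intror (or_introl eq_refl))
      (or_introl eq_refl) (m y z / 2) 0 ltac:(lra)
      ltac:(pose proof (hpos x y); lra)).
    (* At parameter 0 [interp] returns [A] whatever the length of the side, 0 included, because the
       quotient has numerator 0. *)
    rewrite xy0 in H.
    replace (interp A B (m x y) 0) with A in H
      by (unfold interp; destruct A; simpl; unfold Rdiv; f_equal; ring).
    rewrite (hsym x z), <- hE, (hsym x).
    pose proof (hpos (cyz (m y z / 2)) x); nra.
- symmetry in hL; assert (y = z) by (apply hzero; exact hL); subst z.
  rewrite hL in hmid |- *; destruct hmid as [hm _]; rewrite hL in hm.
  replace (cyz (0 / 2)) with y by (apply hzero; lra); lra.
Qed.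

(** Midpoints are unique: inserting [p] itself in the inequality for the geodesic midpoint [q] makes
    the right side 0. *)
Lemma CAT0_cn (hX : CAT0 m) : cn_inequality.
Proof.
intros x y z p [hy hz].
destruct (CAT0_geodesic_midpoint hX y z) as [q [_ hq]].
destruct hX as [[hpos [hzero [hsym _]]] _].
replace p with q; [apply hq |].
symmetry; apply hzero; specialize (hq p).
rewrite (hsym p y), hy, hz in hq; pose proof (hpos p q); nra.
Qed.

Lemma CAT0_has_midpoints (hX : CAT0 m) : has_midpoints.
Proof.
intros y z; destruct (CAT0_geodesic_midpoint hX y z) as [q [hq _]].
now exists q.
Qed.

(** The CN inequality bounds the distances from [p'] and [q] to a midpoint [r] of the diagonal from
    [p] to [q']; the other diagonal is at most the path through [r]. *)
Lemma four_point (hm : is_metric m) (hcn : cn_inequality) (hmid : has_midpoints)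
  (p p' q q' : X) :
  m p q' ^ 2 + m p' q ^ 2 <= m p q ^ 2 + m p' q' ^ 2 + m p p' ^ 2 + m q q' ^ 2.
Proof.
destruct hm as [hpos [_ [hsym htri]]].
destruct (hmid p q') as [r hr].
pose proof (hcn p' p q' r hr) as h1; pose proof (hcn q p q' r hr) as h2.
pose proof (htri p' r q) as h3; rewrite (hsym r q) in h3.
rewrite (hsym p' p) in h1; rewrite (hsym q p) in h2.
pose proof (hpos p' q); pose proof (hpos p' r); pose proof (hpos q r).
assert (m p' q ^ 2 <= (m p' r + m q r) ^ 2) by (apply pow_incr; lra).
assert ((m p' r + m q r) ^ 2 <= 2 * m p' r ^ 2 + 2 * m q r ^ 2)
  by (pose proof (pow2_ge_0 (m p' r - m q r)); nra).
lra.
Qed.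

End CN.

Section Chains.
Variables (X : Type) (d d' : X -> X -> R).
Hypotheses (hd : CAT0 d) (hd' : CAT0 d').
Hypothesis hball : forall x y, d x y <= 1 <-> d' x y <= 1.

(** A geodesic is cut into pieces of length at most 1, which transfer one by one and add up by the
    triangle inequality. Only one implication between unit balls is assumed, so that the lemma
    applies in both directions. *)
Lemma le_nat_transfer (e e' : X -> X -> R) (he : CAT0 e) (he' : CAT0 e')
  (h : forall x y, e x y <= 1 -> e' x y <= 1) (n : nat) :
  forall x y, e x y <= INR n + 1 -> e' x y <= INR n + 1.
Proof.
destruct he as [[hpos [_ [hsym _]]] [hgeo _]].
destruct he' as [[_ [_ [_ htri]]] _].
induction n as [|n IH]; intros x y hxy.
{ simpl in *; rewrite Rplus_0_l in *; auto. }
rewrite S_INR in *; pose proof (pos_INR n).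
destruct (Rle_dec (e x y) (INR n + 1)) as [hle | hgt].
- apply IH in hle; lra.
- destruct (hgeo x y) as [c [[_ hc] [c0 c1]]].
  assert (h1 : e x (c (INR n + 1)) <= INR n + 1).
  { rewrite <- c0 at 1; rewrite hc by lra; rewrite Rabs_left1; lra. }
  assert (h2 : e (c (INR n + 1)) y <= 1).
  { rewrite <- c1 at 1; rewrite hc by lra; rewrite Rabs_left1; lra. }
  apply IH in h1; apply h in h2.
  pose proof (htri x (c (INR n + 1)) y); lra.
Qed.

(* Along a [d]-segment of integer length [n] the point at distance 1 from the
   origin is determined by unit balls; a shorter [d']-segment would leave room
   for two candidates. *)
Lemma eq_nat_transfer (n : nat) (x y : X) :
  d x y = INR n + 2 -> d' x y = INR n + 2.
Proof.
intro hxy.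
assert (hle : d' x y <= INR n + 2).
{ replace (INR n + 2) with (INR (S n) + 1) by (rewrite S_INR; ring).
  apply (le_nat_transfer hd hd'); [intros; now apply hball | rewrite S_INR; lra]. }
destruct hle as [hlt | heq]; [exfalso | exact heq].
assert (hback : forall z, d' x z <= 1 -> d' z y <= INR n + 1 ->
  d x z <= 1 /\ d z y <= INR n + 1).
{ intros z h1 h2; split; [now apply hball |].
  apply (le_nat_transfer hd' hd); [intros; now apply hball | exact h2]. }
pose proof (CAT0_cn hd) as hcn; pose proof (CAT0_has_midpoints hd) as hmid.
destruct hd as [[hpos [hzero [hsym htri]]] _].
destruct hd' as [[hpos' [hzero' [hsym' htri']]] [hgeo' _]].
destruct (hgeo' x y) as [c [[_ hc] [c0 c1]]].
pose proof (pos_INR n).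
assert (hL : 0 < d' x y).
{ destruct (hpos' x y) as [h | h]; [exact h | exfalso].
  symmetry in h; apply hzero' in h; apply hzero in h; lra. }
set (L := d' x y) in *.
assert (hpt : forall u, 0 <= u <= L -> u <= 1 -> L - u <= INR n + 1 ->
  d x (c u) <= 1 /\ d (c u) y <= INR n + 1).
{ intros u h1 h2 h3; apply hback.
  - rewrite <- c0 at 1; rewrite hc by lra; rewrite Rabs_left1; lra.
  - rewrite <- c1 at 1; rewrite hc by lra; rewrite Rabs_left1; lra. }
(* Every parameter in [[u1, u2]] gives a candidate, and [L < INR n + 2] makes this interval
   nondegenerate. *)
set (u1 := Rmax 0 (L - INR n - 1)); set (u2 := Rmin 1 L).
assert (hu : 0 <= u1 /\ u1 < u2 /\ u2 <= L /\ u2 <= 1 /\ L - u1 <= INR n + 1).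
{ unfold u1, u2, Rmax, Rmin; repeat destruct Rle_dec; repeat split; lra. }
destruct (hpt u1) as [a1 b1]; try lra.
destruct (hpt u2) as [a2 b2]; try lra.
assert (hne : 0 < d (c u1) (c u2)).
{ destruct (hpos (c u1) (c u2)) as [h | h]; [exact h | exfalso].
  symmetry in h; apply hzero in h; apply hzero' in h.
  rewrite hc, Rabs_left1 in h by lra; lra. }
(* By the CN inequality the midpoint of two distinct candidates is strictly closer than 1 to [x] and
   than [INR n + 1] to [y], against [d x y = INR n + 2]. *)
destruct (hmid (c u1) (c u2)) as [p hp].
pose proof (hcn x _ _ _ hp) as e1; pose proof (hcn y _ _ _ hp) as e2.
pose proof (htri x p y) as e3.
rewrite !(hsym y) in e2.
pose proof (hpos x (c u1)); pose proof (hpos x (c u2)); pose proof (hpos x p).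
pose proof (hpos (c u1) y); pose proof (hpos (c u2) y); pose proof (hpos p y).
assert (d x (c u1) ^ 2 <= 1) by nra.
assert (d x (c u2) ^ 2 <= 1) by nra.
assert (d (c u1) y ^ 2 <= (INR n + 1) ^ 2) by (apply pow_incr; lra).
assert (d (c u2) y ^ 2 <= (INR n + 1) ^ 2) by (apply pow_incr; lra).
assert (0 < d (c u1) (c u2) ^ 2) by nra.
assert (d x p < 1) by nra.
assert (d p y < INR n + 1) by nra.
lra.
Qed.

End Chains.

(** * Parallel lines sampled at integer times *)

Lemma le_of_forall_inv (x C : R) : (forall K, 0 < K -> x <= C / K) -> x <= 0.
Proof.
intro h; destruct (Rle_dec x 0) as [hx | hx]; [exact hx | exfalso].
apply Rnot_le_lt in hx.
assert (hK : 0 < 2 * (Rabs C + 1) / x).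
{ apply Rdiv_lt_0_compat; [pose proof (Rabs_pos C) |]; lra. }
specialize (h _ hK).
pose proof (Rle_abs C); pose proof (Rabs_pos C).
assert (C / (2 * (Rabs C + 1) / x) <= x / 2).
{ apply (Rmult_le_reg_r (2 * (Rabs C + 1) / x)); [exact hK |].
  replace (C / (2 * (Rabs C + 1) / x) * (2 * (Rabs C + 1) / x)) with C
    by (field; lra).
  replace (x / 2 * (2 * (Rabs C + 1) / x)) with (Rabs C + 1) by (field; lra).
  lra. }
lra.
Qed.

(** By convexity a positive increment [e] persists, so the sequence grows at least linearly and
    exceeds [B]. *)
Lemma convex_bounded_decreasing (a : Z -> R) (B : R) :
  (forall i, 0 <= a i <= B) ->
  (forall i, 2 * a i <= a (i - 1)%Z + a (i + 1)%Z) ->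
  forall i, a (i + 1)%Z <= a i.
Proof.
intros hB hc i.
destruct (Rle_dec (a (i + 1)%Z) (a i)) as [h | h]; [exact h | exfalso].
apply Rnot_le_lt in h.
set (e := a (i + 1)%Z - a i).
assert (hn : forall n : nat,
  e <= a (i + Z.of_nat n + 1)%Z - a (i + Z.of_nat n)%Z /\
  a i + INR n * e <= a (i + Z.of_nat n)%Z).
{ induction n as [|n [IH1 IH2]].
  - replace (i + Z.of_nat 0)%Z with i by lia; simpl INR; unfold e; split; lra.
  - rewrite S_INR.
    replace (i + Z.of_nat (S n))%Z with (i + Z.of_nat n + 1)%Z by lia.
    pose proof (hc (i + Z.of_nat n + 1)%Z) as h1.
    replace (i + Z.of_nat n + 1 - 1)%Z with (i + Z.of_nat n)%Z in h1 by lia.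
    split; lra. }
destruct (INR_unbounded (B / e)) as [n hnB].
destruct (hn n) as [_ h1].
pose proof (hB i); pose proof (hB (i + Z.of_nat n)%Z).
assert (he : 0 < e) by (unfold e; lra).
apply (Rmult_lt_compat_r e) in hnB; [| exact he].
replace (B / e * e) with B in hnB by (field; lra); lra.
Qed.

Lemma convex_bounded_constant (a : Z -> R) (B : R) :
  (forall i, 0 <= a i <= B) ->
  (forall i, 2 * a i <= a (i - 1)%Z + a (i + 1)%Z) ->
  forall i, a i = a 0%Z.
Proof.
intros hB hc.
assert (h : forall i, a (i + 1)%Z = a i).
{ intro i; apply Rle_antisym; [now apply convex_bounded_decreasing with B |].
  pose proof (@convex_bounded_decreasing (fun j => a (- j)%Z) B
    (fun j => hB (- j)%Z)) as h; cbv beta in h.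
  specialize (h) with (i := (- i - 1)%Z).
  replace (- (- i - 1 + 1))%Z with i in h by lia.
  replace (- (- i - 1))%Z with (i + 1)%Z in h by lia.
  apply h; intro j; specialize (hc (- j)%Z).
  replace (- (j - 1))%Z with (- j + 1)%Z by lia.
  replace (- (j + 1))%Z with (- j - 1)%Z by lia. lra. }
intro i; induction i as [| i IH | i IH] using Z.peano_ind; [reflexivity | |].
- rewrite <- Z.add_1_r, h; exact IH.
- rewrite <- IH, <- (h (Z.pred i)); f_equal; lia.
Qed.

Lemma affine_of_second_difference (g : Z -> R) :
  (forall i, g (i - 1)%Z + g (i + 1)%Z = 2 * g i) ->
  forall i, g i = g 0%Z + IZR i * (g 1%Z - g 0%Z).
Proof.
intro hg.
assert (h : forall i, g i = g 0%Z + IZR i * (g 1%Z - g 0%Z) /\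
  g (i + 1)%Z = g 0%Z + IZR (i + 1) * (g 1%Z - g 0%Z)).
{ intro i; induction i as [| i [IH1 IH2] | i [IH1 IH2]] using Z.peano_ind.
  - simpl; split; ring.
  - unfold Z.succ; split; [exact IH2 |].
    specialize (hg (i + 1)%Z); replace (i + 1 - 1)%Z with i in hg by lia.
    rewrite !plus_IZR in *; nra.
  - specialize (hg i).
    replace (Z.pred i) with (i - 1)%Z by lia.
    replace (i - 1 + 1)%Z with i by lia.
    rewrite !plus_IZR, minus_IZR in *; split; nra. }
intro i; apply h.
Qed.

Section ZLines.
Variables (X : Type) (m : X -> X -> R).
Hypotheses (hm : is_metric m) (hcn : cn_inequality m) (hmid : has_midpoints m).

Definition zline (P : Z -> X) : Prop :=
  forall i j, m (P i) (P j) = Rabs (IZR i - IZR j).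

Definition parallel (P Q : Z -> X) : Prop :=
  exists B, forall i, m (P i) (Q i) <= B.

(* A pair of parallel lines spans a Euclidean strip; [offset] is the difference
   of the heights of [Q 0] and [P 0] along the strip, [sep2] its squared width. *)
Definition offset (P Q : Z -> X) : R :=
  (m (P 0%Z) (Q 1%Z) ^ 2 - m (P 0%Z) (Q 0%Z) ^ 2 - 1) / 2.

Definition sep2 (P Q : Z -> X) : R := m (P 0%Z) (Q 0%Z) ^ 2 - offset P Q ^ 2.

Lemma zline_midpoint P (hP : zline P) i k :
  (0 <= k)%Z -> midpoint m (P (i - k)%Z) (P (i + k)%Z) (P i).
Proof.
intro hk; apply IZR_le in hk.
unfold midpoint; rewrite !hP, plus_IZR, minus_IZR.
rewrite !Rabs_left1 by lra; split; lra.
Qed.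

Lemma zline_cn P (hP : zline P) x i :
  2 * m x (P i) ^ 2 <= m x (P (i - 1)%Z) ^ 2 + m x (P (i + 1)%Z) ^ 2 - 2.
Proof.
pose proof (hcn x (@zline_midpoint P hP i 1%Z ltac:(lia))) as h.
rewrite (hP (i - 1)%Z), plus_IZR, minus_IZR, Rabs_left1 in h by lra; lra.
Qed.

(** The left side is bounded in [i] and discretely convex, hence constant. Convexity combines the CN
    inequality on [P] seen from [Q k], on [Q] seen from both neighbours of [P j], and the four-point
    inequality for the neighbours on both lines. *)
Lemma parallel_shift P Q (hP : zline P) (hQ : zline Q) (hPQ : parallel P Q) i v :
  m (P i) (Q (i + v)%Z) ^ 2 = m (P 0%Z) (Q v) ^ 2.
Proof.
destruct hPQ as [B hB].
destruct hm as [hpos [_ [hsym htri]]].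
apply (@convex_bounded_constant (fun i => m (P i) (Q (i + v)%Z) ^ 2)
  ((B + Rabs (IZR v)) ^ 2)).
- intro j; split; [apply pow2_ge_0 | apply pow_incr; split; [apply hpos |]].
  pose proof (htri (P j) (Q j) (Q (j + v)%Z)) as h.
  rewrite hQ, plus_IZR in h; specialize (hB j).
  replace (IZR j - (IZR j + IZR v)) with (- IZR v) in h by ring.
  rewrite Rabs_Ropp in h; lra.
- intro j.
  replace (j - 1 + v)%Z with (j + v - 1)%Z by lia.
  replace (j + 1 + v)%Z with (j + v + 1)%Z by lia.
  set (k := (j + v)%Z).
  pose proof (zline_cn hP (Q k) j) as h1.
  pose proof (zline_cn hQ (P (j - 1)%Z) k) as h2.
  pose proof (zline_cn hQ (P (j + 1)%Z) k) as h3.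
  pose proof (four_point hm hcn hmid (P (j - 1)%Z) (P (j + 1)%Z)
    (Q (k - 1)%Z) (Q (k + 1)%Z)) as h4.
  rewrite (hP (j - 1)%Z), (hQ (k - 1)%Z) in h4.
  rewrite !plus_IZR, !minus_IZR, !Rabs_left1 in h4 by lra.
  rewrite !(hsym (Q k)) in h1.
  nra.
Qed.

(** The squared distance [psi] depends on the index difference only. Its second difference is at
    least 2 by the CN inequality and at most 2 by the four-point inequality, so [psi v] minus
    [v ^ 2] is affine. *)
Lemma parallel_dist_sq P Q (hP : zline P) (hQ : zline Q) (hPQ : parallel P Q) i j :
  m (P i) (Q j) ^ 2 = sep2 P Q + (IZR j - IZR i + offset P Q) ^ 2.
Proof.
set (psi := fun v => m (P 0%Z) (Q v) ^ 2).
assert (hpsi : forall i v, m (P i) (Q (i + v)%Z) ^ 2 = psi v)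
  by (intros; now apply parallel_shift).
destruct hm as [hpos [_ [hsym htri]]].
assert (hdiff : forall v, psi (v - 1)%Z + psi (v + 1)%Z = 2 * psi v + 2).
{ intro v.
  pose proof (zline_cn hQ (P 0%Z) v) as h1.
  pose proof (four_point hm hcn hmid (P 0%Z) (P 1%Z) (Q v) (Q (v + 1)%Z)) as h2.
  rewrite hP, hQ, plus_IZR, !Rabs_left1 in h2 by lra.
  pose proof (hpsi 1%Z (v - 1)%Z) as h3; pose proof (hpsi 1%Z v) as h4.
  replace (1 + (v - 1))%Z with v in h3 by lia.
  rewrite Z.add_comm in h4.
  unfold psi in *; simpl Z.add in *; nra. }
pose proof (@affine_of_second_difference (fun v => psi v - IZR v ^ 2)) as haff.
cbv beta in haff.
specialize (haff) with (i := (j - i)%Z).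
replace j with (i + (j - i))%Z at 1 by lia; rewrite hpsi.
rewrite minus_IZR in haff.
assert (hs : psi (j - i)%Z - (IZR j - IZR i) ^ 2 =
  psi 0%Z - 0 ^ 2 + (IZR j - IZR i) * (psi 1%Z - 1 ^ 2 - (psi 0%Z - 0 ^ 2))).
{ apply haff; intro v; specialize (hdiff v).
  rewrite plus_IZR, minus_IZR; nra. }
unfold sep2, offset; fold (psi 0%Z) (psi 1%Z). 
replace (psi (j - i)%Z) with ((IZR j - IZR i) ^ 2 + (psi 0%Z - 0 ^ 2 +
  (IZR j - IZR i) * (psi 1%Z - 1 ^ 2 - (psi 0%Z - 0 ^ 2)))) by lra.
field.
Qed.

(** Tangent bound for the square root. [E] may be negative; it is at least [- u ^ 2], which keeps
    the right side nonnegative. *)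
Lemma le_first_order (y u E : R) :
  0 < u -> y ^ 2 = E + u ^ 2 -> y <= u + E / (2 * u).
Proof.
intros hu hy.
assert (hE : E / (2 * u) * (2 * u) = E) by (field; lra).
set (q := E / (2 * u)) in *.
assert (0 <= u + q) by (apply (Rmult_le_reg_r (2 * u)); nra).
apply Rsqr_incr_0_var; [unfold Rsqr; nra | assumption].
Qed.

Lemma integer_above (x : R) : exists n : Z, x < IZR n <= x + 1.
Proof. exists (up x); pose proof (archimed x); lra. Qed.

(** The detour from [P (- n)] to [P n] through [Q 0] has length at least [2 n], and at most [2 n]
    plus a positive multiple of [E] once [n] exceeds [Rabs a]. *)
Lemma sep2_nonneg P Q (hP : zline P) (hQ : zline Q) (hPQ : parallel P Q) :
  0 <= sep2 P Q.
Proof.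
pose proof (parallel_dist_sq hP hQ hPQ) as hd.
destruct hm as [hpos [_ [hsym htri]]].
set (a := offset P Q) in *; set (E := sep2 P Q) in *.
destruct (integer_above (Rabs a)) as [n [hn _]].
pose proof (Rle_abs a); pose proof (Rle_abs (- a)); rewrite Rabs_Ropp in *.
pose proof (hd (- n)%Z 0%Z) as h1; pose proof (hd n 0%Z) as h2.
rewrite opp_IZR in h1.
pose proof (@le_first_order (m (P (- n)%Z) (Q 0%Z)) (IZR n + a) E ltac:(lra) ltac:(rewrite h1; ring)) as h1'.
pose proof (@le_first_order (m (P n) (Q 0%Z)) (IZR n - a) E ltac:(lra) ltac:(rewrite h2; ring)) as h2'.
pose proof (htri (P (- n)%Z) (Q 0%Z) (P n)) as h3.
rewrite hP, opp_IZR, Rabs_left1, (hsym (Q 0%Z)) in h3 by lra.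
assert (h4 : 0 <= E / (2 * (IZR n + a)) + E / (2 * (IZR n - a))) by lra.
replace (E / (2 * (IZR n + a)) + E / (2 * (IZR n - a)))
  with (E * (IZR n / ((IZR n + a) * (IZR n - a)))) in h4 by (field; lra).
assert (0 < IZR n / ((IZR n + a) * (IZR n - a))).
{ pose proof (Rabs_pos a); apply Rdiv_lt_0_compat; [lra | nra]. }
nra.
Qed.

Lemma parallel_sym P Q : parallel P Q -> parallel Q P.
Proof.
destruct hm as [_ [_ [hsym _]]].
intros [B hB]; exists B; intro i; rewrite hsym; apply hB.
Qed.

Lemma parallel_trans P Q S : parallel P Q -> parallel Q S -> parallel P S.
Proof.
destruct hm as [_ [_ [_ htri]]].
intros [B hB] [C hC]; exists (B + C); intro i.
pose proof (htri (P i) (Q i) (S i)); specialize (hB i); specialize (hC i); lra.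
Qed.

Lemma offset_sym P Q (hP : zline P) (hQ : zline Q) (hPQ : parallel P Q) :
  offset Q P = - offset P Q.
Proof.
pose proof (parallel_dist_sq hP hQ hPQ 0%Z 0%Z) as h0.
pose proof (parallel_dist_sq hP hQ hPQ 1%Z 0%Z) as h1.
destruct hm as [_ [_ [hsym _]]].
unfold offset at 1; rewrite !(hsym (Q 0%Z)), h0, h1; simpl; field.
Qed.

Lemma sep2_sym P Q (hP : zline P) (hQ : zline Q) (hPQ : parallel P Q) :
  sep2 Q P = sep2 P Q.
Proof.
unfold sep2 at 1; rewrite (offset_sym hP hQ hPQ); unfold sep2.
destruct hm as [_ [_ [hsym _]]]; rewrite (hsym (Q 0%Z)); ring.
Qed.

(* The broken line from [P 0] through [Q M] to [S (M + N)], with height gains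
   [u1 = M + offset P Q] and [u2 = N + offset Q S]. *)
Lemma broken_line_le P Q S (hP : zline P) (hQ : zline Q) (hS : zline S)
  (hPQ : parallel P Q) (hQS : parallel Q S) (M N : Z) :
  0 < IZR M + offset P Q -> 0 < IZR N + offset Q S ->
  exists y, 0 <= y /\
    y ^ 2 = sep2 P S + (IZR M + IZR N + offset P S) ^ 2 /\
    y <= (IZR M + offset P Q) + sep2 P Q / (2 * (IZR M + offset P Q)) +
         ((IZR N + offset Q S) + sep2 Q S / (2 * (IZR N + offset Q S))).
Proof.
intros h1 h2.
pose proof (parallel_dist_sq hP hS (parallel_trans hPQ hQS) 0%Z (M + N)%Z) as e0.
pose proof (parallel_dist_sq hP hQ hPQ 0%Z M) as e1.
pose proof (parallel_dist_sq hQ hS hQS M (M + N)%Z) as e2.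
rewrite plus_IZR in e0, e2.
destruct hm as [hpos [_ [_ htri]]].
exists (m (P 0%Z) (S (M + N)%Z)); split; [apply hpos |]; split.
- rewrite e0; ring.
- pose proof (@le_first_order (m (P 0%Z) (Q M)) _ (sep2 P Q) h1 ltac:(rewrite e1; ring)) as f1.
  pose proof (@le_first_order (m (Q M) (S (M + N)%Z)) _ (sep2 Q S) h2 ltac:(rewrite e2; ring)) as f2.
  pose proof (htri (P 0%Z) (Q M) (S (M + N)%Z)); lra.
Qed.

Lemma div_le_div_of_le (E K u : R) : 0 <= E -> 0 < K -> K <= u -> E / u <= E / K.
Proof.
intros hE hK hu; unfold Rdiv; apply Rmult_le_compat_l; [exact hE |].
now apply Rinv_le_contravar.
Qed.

(** For long legs the width corrections of the broken line vanish and only the heights remain.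
    Reversing the path then gives the opposite inequality in [offset_additive]. *)
Lemma offset_subadditive P Q S (hP : zline P) (hQ : zline Q) (hS : zline S)
  (hPQ : parallel P Q) (hQS : parallel Q S) :
  offset P S <= offset P Q + offset Q S.
Proof.
cut (offset P S - offset P Q - offset Q S <= 0); [lra |].
apply le_of_forall_inv with (C := sep2 P Q + sep2 Q S); intros K hK.
destruct (integer_above (K - offset P Q)) as [M hM].
destruct (integer_above (K - offset Q S)) as [N hN].
destruct (broken_line_le hP hQ hS hPQ hQS M N) as [y [hy0 [hy1 hy2]]]; try lra.
pose proof (sep2_nonneg hP hQ hPQ) as n1; pose proof (sep2_nonneg hQ hS hQS) as n2.
pose proof (sep2_nonneg hP hS (parallel_trans hPQ hQS)) as n3.
assert (IZR M + IZR N + offset P S <= y)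
  by (apply Rsqr_incr_0_var; [unfold Rsqr; nra | exact hy0]).
pose proof (@div_le_div_of_le (sep2 P Q) K (2 * (IZR M + offset P Q)) n1 hK ltac:(lra)).
pose proof (@div_le_div_of_le (sep2 Q S) K (2 * (IZR N + offset Q S)) n2 hK ltac:(lra)).
unfold Rdiv in *; lra.
Qed.

Lemma offset_additive P Q S (hP : zline P) (hQ : zline Q) (hS : zline S)
  (hPQ : parallel P Q) (hQS : parallel Q S) :
  offset P S = offset P Q + offset Q S.
Proof.
apply Rle_antisym; [now apply offset_subadditive |].
pose proof (offset_subadditive hS hQ hP (parallel_sym hQS) (parallel_sym hPQ)) as h.
rewrite (offset_sym hQ hS hQS), (offset_sym hP hQ hPQ) in h.
rewrite (offset_sym hP hS (parallel_trans hPQ hQS)) in h; lra.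
Qed.

Lemma sep_triangle P Q S (hP : zline P) (hQ : zline Q) (hS : zline S)
  (hPQ : parallel P Q) (hQS : parallel Q S) :
  sqrt (sep2 P S) <= sqrt (sep2 P Q) + sqrt (sep2 Q S).
Proof.
pose proof (sep2_nonneg hP hQ hPQ) as n1; pose proof (sep2_nonneg hQ hS hQS) as n2.
pose proof (sep2_nonneg hP hS (parallel_trans hPQ hQS)) as n3.
set (A := sqrt (sep2 P Q)); set (B := sqrt (sep2 Q S)).
assert (hA : 0 <= A) by apply sqrt_pos; assert (hB : 0 <= B) by apply sqrt_pos.
assert (hA2 : sep2 P Q = A ^ 2) by (unfold A; now rewrite pow2_sqrt).
assert (hB2 : sep2 Q S = B ^ 2) by (unfold B; now rewrite pow2_sqrt).
rewrite <- (sqrt_pow2 (A + B)) by lra; apply sqrt_le_1_alt.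
cut (sep2 P S - (A + B) ^ 2 <= 0); [lra |].
(* Legs with slopes proportional to the two widths make the two first-order
   corrections add up to [(A + B) / (2 K)]. *)
cut (forall K, 1 <= K -> sep2 P S - (A + B) ^ 2 <= (2 * (A + B) + (A + B) ^ 2) / K).
{ intro h; apply le_of_forall_inv with (C := 2 * (A + B) + (A + B) ^ 2).
  intros K hK; destruct (Rle_dec 1 K) as [h1 | h1]; [now apply h |].
  specialize (h 1 ltac:(lra)).
  assert ((2 * (A + B) + (A + B) ^ 2) / 1 <= (2 * (A + B) + (A + B) ^ 2) / K)
    by (apply div_le_div_of_le; nra).
  lra. }
intros K hK.
destruct (integer_above (K * A - offset P Q)) as [M hM].
destruct (integer_above (K * B - offset Q S)) as [N hN].
assert (0 <= K * A) by nra; assert (0 <= K * B) by nra.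
destruct (broken_line_le hP hQ hS hPQ hQS M N) as [y [hy0 [hy1 hy2]]]; try lra.
rewrite (offset_additive hP hQ hS hPQ hQS), hA2, hB2 in *.
assert (haux : forall u W, 0 <= W -> K * W < u -> W ^ 2 / (2 * u) <= W / (2 * K)).
{ intros u W hW hu; assert (0 < u) by nra.
  apply (Rmult_le_reg_r (2 * u * K)); [nra |].
  replace (W ^ 2 / (2 * u) * (2 * u * K)) with (W * (K * W)) by (field; lra).
  replace (W / (2 * K) * (2 * u * K)) with (W * u) by (field; lra).
  apply Rmult_le_compat_l; lra. }
pose proof (haux (IZR M + offset P Q) A hA ltac:(lra)) as f1.
pose proof (haux (IZR N + offset Q S) B hB ltac:(lra)) as f2.
set (u1 := IZR M + offset P Q) in *; set (u2 := IZR N + offset Q S) in *.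
replace (IZR M + IZR N + (offset P Q + offset Q S)) with (u1 + u2) in hy1
  by (unfold u1, u2; ring).
set (z := (A + B) / (2 * K)).
assert (hz : z * K = (A + B) / 2) by (unfold z; field; lra).
assert (hz0 : 0 <= z).
{ unfold z; apply Rmult_le_pos; [lra |]; left; apply Rinv_0_lt_compat; lra. }
assert (hyz : y <= u1 + u2 + z).
{ replace z with (A / (2 * K) + B / (2 * K)) by (unfold z; field; lra); lra. }
assert (hu : 0 < u1 + u2 <= K * (A + B) + 2) by (unfold u1, u2; split; nra).
assert (y ^ 2 <= (u1 + u2 + z) ^ 2) by (apply pow_incr; lra).
assert (h5 : sep2 P S <= 2 * (u1 + u2) * z + z ^ 2) by nra.
apply (Rmult_le_reg_r K); [lra |].
replace ((2 * (A + B) + (A + B) ^ 2) / K * K) with (2 * (A + B) + (A + B) ^ 2)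
  by (field; lra).
assert ((u1 + u2) * z <= (K * (A + B) + 2) * z) by (apply Rmult_le_compat_r; lra).
assert (hz1 : z <= (A + B) / 2) by nra.
assert (z ^ 2 * K <= (A + B) ^ 2 / 4).
{ replace (z ^ 2 * K) with (z * (z * K)) by ring; rewrite hz; nra. }
assert (h6 : sep2 P S * K <= 2 * ((K * (A + B) + 2) * z) * K + z ^ 2 * K) by nra.
replace (2 * ((K * (A + B) + 2) * z) * K)
  with (2 * (K * (A + B) + 2) * (z * K)) in h6 by ring.
rewrite hz in h6; nra.
Qed.

End ZLines.

(** * A strip whose integer distances are known *)

Lemma nat_floor_from_two (y : R) : 2 <= y -> exists n : nat, INR n + 2 <= y < INR n + 3.
Proof.
intro hy; pose proof (archimed y) as [h1 h2].
assert (h3 : (2 < up y)%Z) by (apply lt_IZR; lra).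
exists (Z.to_nat (up y - 3)).
rewrite INR_IZR_INZ, Z2Nat.id by lia; rewrite minus_IZR; lra.
Qed.

Section Strip.
Variables (X : Type) (m : X -> X -> R) (S : R -> R -> X) (w : R).
Hypotheses (hm : is_metric m) (hcn : cn_inequality m) (hmid : has_midpoints m).
Hypothesis hw : 0 < w.
(** These two hypotheses are what is carried over from the Euclidean strip. Equality starts at 2,
    since unit balls give distance 1 only as an upper bound. *)
Hypothesis S_le : forall t1 x1 t2 x2 n, 0 <= x1 <= w -> 0 <= x2 <= w ->
  (t1 - t2) ^ 2 + (x1 - x2) ^ 2 <= (INR n + 1) ^ 2 ->
  m (S t1 x1) (S t2 x2) <= INR n + 1.
Hypothesis S_eq : forall t1 x1 t2 x2 n, 0 <= x1 <= w -> 0 <= x2 <= w ->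
  (t1 - t2) ^ 2 + (x1 - x2) ^ 2 = (INR n + 2) ^ 2 ->
  m (S t1 x1) (S t2 x2) = INR n + 2.

Definition line (t x : R) (i : Z) : X := S (t + IZR i) x.

Lemma line_dist_nat t x (hx : 0 <= x <= w) (n : nat) :
  m (S t x) (S (t + INR n) x) = INR n.
Proof.
destruct hm as [hpos [hzero [hsym htri]]].
destruct n as [|[|n]].
- simpl; rewrite Rplus_0_r; now apply hzero.
(* Distance 1 is recovered from two consecutive bounds by 1 against the exact distance 2. *)
- pose proof (@S_le t x (t + 1) x 0 hx hx ltac:(simpl; nra)) as h1.
  pose proof (@S_le (t + 1) x (t + 2) x 0 hx hx ltac:(simpl; nra)) as h2.
  pose proof (@S_eq t x (t + 2) x 0 hx hx ltac:(simpl; nra)) as h3.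
  pose proof (htri (S t x) (S (t + 1) x) (S (t + 2) x)).
  simpl in *; lra.
- rewrite !S_INR; replace (INR n + 1 + 1) with (INR n + 2) by ring.
  apply S_eq; auto; ring.
Qed.

Lemma line_zline t x (hx : 0 <= x <= w) : zline m (line t x).
Proof.
assert (h : forall i j, (i <= j)%Z ->
  m (line t x i) (line t x j) = Rabs (IZR i - IZR j)).
{ intros i j hij; unfold line.
  replace (t + IZR j) with (t + IZR i + INR (Z.to_nat (j - i))).
  - rewrite line_dist_nat by auto.
    rewrite INR_IZR_INZ, Z2Nat.id, minus_IZR by lia.
    apply IZR_le in hij; rewrite Rabs_left1; lra.
  - rewrite INR_IZR_INZ, Z2Nat.id, minus_IZR by lia; ring. }
intros i j; destruct (Z.le_ge_cases i j) as [hij | hij]; [now apply h |].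
destruct hm as [_ [_ [hsym _]]].
rewrite hsym, h, Rabs_minus_sym by exact hij; reflexivity.
Qed.

Lemma line_parallel t1 x1 t2 x2 :
  0 <= x1 <= w -> 0 <= x2 <= w -> parallel m (line t1 x1) (line t2 x2).
Proof.
intros h1 h2.
destruct (INR_unbounded ((t1 - t2) ^ 2 + (x1 - x2) ^ 2)) as [n hn].
exists (INR n + 1); intro i; apply S_le; auto.
replace (t1 + IZR i - (t2 + IZR i)) with (t1 - t2) by ring.
pose proof (pos_INR n); nra.
Qed.

(** * Height and separation coordinates on the strip *)

Definition height (t x : R) : R := offset m (line 0 0) (line t x).
Definition sep (t1 x1 t2 x2 : R) : R := sqrt (sep2 m (line t1 x1) (line t2 x2)).

Lemma in_0 : 0 <= 0 <= w. Proof. lra. Qed.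

Local Hint Resolve line_zline line_parallel in_0 : core.

Lemma sep_nonneg t1 x1 t2 x2 : 0 <= sep t1 x1 t2 x2.
Proof. apply sqrt_pos. Qed.

Lemma sep_sym t1 x1 t2 x2 : 0 <= x1 <= w -> 0 <= x2 <= w ->
  sep t1 x1 t2 x2 = sep t2 x2 t1 x1.
Proof. intros; unfold sep; now rewrite sep2_sym by auto. Qed.

Lemma sep_tri t2 x2 t1 x1 t3 x3 : 0 <= x1 <= w -> 0 <= x2 <= w -> 0 <= x3 <= w ->
  sep t1 x1 t3 x3 <= sep t1 x1 t2 x2 + sep t2 x2 t3 x3.
Proof. intros; unfold sep; apply sep_triangle; auto. Qed.

(** Pythagoras for two parallel lines; additivity of [offset] allows all heights to be measured from
    one reference line. *)
Lemma strip_dist_sq t1 x1 t2 x2 : 0 <= x1 <= w -> 0 <= x2 <= w ->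
  m (S t1 x1) (S t2 x2) ^ 2 =
  sep t1 x1 t2 x2 ^ 2 + (height t2 x2 - height t1 x1) ^ 2.
Proof.
intros h1 h2; unfold sep; rewrite pow2_sqrt by (apply sep2_nonneg; auto).
unfold height.
rewrite (@offset_additive X m hm hcn hmid (line 0 0) (line t1 x1) (line t2 x2)) by auto.
unfold sep2, line; simpl IZR; rewrite !Rplus_0_r; ring.
Qed.

Lemma line_shift t x (hx : 0 <= x <= w) n :
  m (S t x) (S (t + IZR n) x) ^ 2 = IZR n ^ 2 /\
  offset m (line t x) (line (t + IZR n) x) = IZR n.
Proof.
assert (h : forall k, m (S t x) (S (t + IZR k) x) ^ 2 = IZR k ^ 2).
{ intro k; pose proof (@line_zline t x hx 0%Z k) as h; unfold line in h.
  rewrite Rplus_0_r in h; rewrite h, pow2_abs; ring. }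
split; [apply h |].
unfold offset, line; rewrite !Rplus_0_r, h.
replace (t + IZR n + 1) with (t + IZR (n + 1)) by (rewrite plus_IZR; ring).
rewrite h, plus_IZR; field.
Qed.

Lemma height_shift t x (hx : 0 <= x <= w) n :
  height (t + IZR n) x = height t x + IZR n.
Proof.
unfold height.
rewrite (@offset_additive X m hm hcn hmid (line 0 0) (line t x)) by auto.
now rewrite (proj2 (line_shift t hx n)).
Qed.

Lemma sep_shift t x (hx : 0 <= x <= w) n : sep t x (t + IZR n) x = 0.
Proof.
unfold sep, sep2; rewrite (proj2 (line_shift t hx n)).
unfold line; rewrite !Rplus_0_r, (proj1 (line_shift t hx n)).
rewrite <- sqrt_0; f_equal; ring.
Qed.

(* [S (t + s) x'] and [S (t + N) x] are at distance exactly [N = n + 2]. *)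
Lemma sep_eq_height t s x x' n : 0 <= x <= w -> 0 <= x' <= w ->
  (x' - x) ^ 2 = s * (2 * (INR n + 2) - s) ->
  sep t x (t + s) x' ^ 2 =
  (height (t + s) x' - height t x) *
  (2 * (INR n + 2) - (height (t + s) x' - height t x)).
Proof.
intros hx hx' h.
set (N := INR n + 2) in *.
assert (hN : N = IZR (Z.of_nat n + 2)) by (unfold N; now rewrite plus_IZR, <- INR_IZR_INZ).
assert (hd : m (S (t + s) x') (S (t + N) x) = N)
  by (apply S_eq; auto; fold N; nra).
pose proof (strip_dist_sq (t + s) (t + N) hx' hx) as e; rewrite hd in e.
assert (hs : sep (t + s) x' (t + N) x = sep t x (t + s) x').
{ rewrite hN.
  pose proof (@sep_shift t x hx (Z.of_nat n + 2)) as z.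
  pose proof (@sep_tri t x (t + s) x' (t + IZR (Z.of_nat n + 2)) x hx' hx hx).
  pose proof (@sep_tri (t + IZR (Z.of_nat n + 2)) x t x (t + s) x' hx hx hx').
  rewrite (sep_sym (t + s) t) in * by auto.
  rewrite (sep_sym (t + IZR (Z.of_nat n + 2)) (t + s)) in * by auto.
  lra. }
rewrite hs in e; replace (height (t + N) x) with (height t x + N) in e
  by (rewrite hN, height_shift; auto).
nra.
Qed.

(** * Lipschitz estimates for the height *)

Lemma unit_step_bounded : exists B, 1 <= B /\ w <= B /\
  forall t s x x', 0 <= x <= w -> 0 <= x' <= w -> 0 <= s <= 1 ->
    sep t x (t + s) x' <= B /\ height (t + s) x' - height t x <= B.
Proof.
destruct (INR_unbounded w) as [n hn]; pose proof (pos_INR n).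
exists (INR n + 1); split; [lra |]; split; [lra |].
intros t s x x' hx hx' hs.
assert (h : m (S t x) (S (t + s) x') <= INR n + 1) by (apply S_le; auto; nra).
pose proof (strip_dist_sq t (t + s) hx hx') as e.
destruct hm as [hpos _]; pose proof (hpos (S t x) (S (t + s) x')).
assert (m (S t x) (S (t + s) x') ^ 2 <= (INR n + 1) ^ 2) by (apply pow_incr; lra).
pose proof (pow2_ge_0 (sep t x (t + s) x')).
pose proof (pow2_ge_0 (height (t + s) x' - height t x)).
split; apply Rsqr_incr_0_var; unfold Rsqr; nra.
Qed.

(** With [k] the height gain and [N] the length, [k * (2 * N - k)] is a square bounded by [B ^ 2].
    Hence [k] is nonnegative, and [k <= B <= N] makes the second factor at least [N]. *)
Lemma height_step : exists B, 1 <= B /\ w <= B /\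
  forall t s x x' n, 0 <= x <= w -> 0 <= x' <= w -> 0 <= s <= 1 ->
    (x' - x) ^ 2 = s * (2 * (INR n + 2) - s) -> B <= INR n + 2 ->
    0 <= height (t + s) x' - height t x <= B ^ 2 / (INR n + 2).
Proof.
destruct unit_step_bounded as [B [hB1 [hBw hB]]].
exists B; split; [exact hB1 |]; split; [exact hBw |].
intros t s x x' n hx hx' hs h hn.
pose proof (@sep_eq_height t s x x' n hx hx' h) as e.
destruct (hB t s x x' hx hx' hs) as [b1 b2].
pose proof (sep_nonneg t x (t + s) x').
set (k := height (t + s) x' - height t x) in *; set (N := INR n + 2) in *.
assert (hk : 0 <= k) by nra.
split; [exact hk |].
apply (Rmult_le_reg_r N); [lra |].
replace (B ^ 2 / N * N) with (B ^ 2) by (field; lra).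
assert (sep t x (t + s) x' ^ 2 <= B ^ 2) by (apply pow_incr; lra).
nra.
Qed.

Lemma opposite_point x e : 0 <= x <= w -> 0 <= e <= w / 2 ->
  exists x', 0 <= x' <= w /\ (x' - x) ^ 2 = e ^ 2 /\ (x - x') ^ 2 = e ^ 2.
Proof.
intros hx he; destruct (Rle_dec x (w / 2));
  [exists (x + e) | exists (x - e)]; repeat split; try lra; ring.
Qed.

(** The step is split into two half-steps, from [x] out to some [x'] and back, each tied to an exact
    segment of length about [w ^ 2 / (4 * s)], so that [height_step] gives a gain of order [s]. *)
Lemma height_lipschitz_local : exists C s1, 0 < C /\ 0 < s1 /\
  forall t s x, 0 <= x <= w -> 0 < s <= s1 ->
    0 <= height (t + s) x - height t x <= C * s.
Proof.
destruct height_step as [B [hB1 [hBw hB]]].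
exists (16 * B ^ 2 / w ^ 2), (Rmin 1 (w ^ 2 / (4 * (B + 2)))).
assert (hw2 : 0 < w ^ 2) by nra.
split; [apply Rdiv_lt_0_compat; nra |].
split; [apply Rmin_glb_lt; [lra | apply Rdiv_lt_0_compat; lra] |].
intros t s x hx [hs hs1].
assert (hs1a : s <= 1) by (eapply Rle_trans; [exact hs1 | apply Rmin_l]).
assert (hs1b : s * (4 * (B + 2)) <= w ^ 2).
{ assert (h : s <= w ^ 2 / (4 * (B + 2))) by (eapply Rle_trans; [exact hs1 | apply Rmin_r]).
  apply (Rmult_le_compat_r (4 * (B + 2))) in h; [| lra].
  replace (w ^ 2 / (4 * (B + 2)) * (4 * (B + 2))) with (w ^ 2) in h by (field; lra).
  exact h. }
(* For [N <= y] the squared lateral move, at most [s * N], does not exceed [(w / 2) ^ 2], so it fits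
   in the strip from any [x]. *)
set (y := w ^ 2 / (4 * s)).
assert (hy : y * (4 * s) = w ^ 2) by (unfold y; field; lra).
assert (hyB : B + 2 <= y) by (apply (Rmult_le_reg_r (4 * s)); lra).
destruct (@nat_floor_from_two y ltac:(lra)) as [n [hn1 hn2]].
assert (hn3 : y < INR n + 2 + 1) by lra.
set (N := INR n + 2) in *.
assert (hq : 0 <= s / 2 * (2 * N - s / 2)) by (apply Rmult_le_pos; lra).
destruct (@opposite_point x (sqrt (s / 2 * (2 * N - s / 2))) hx) as [x' [hx' [e1 e2]]].
{ split; [apply sqrt_pos |].
  rewrite <- (sqrt_pow2 (w / 2)) by lra; apply sqrt_le_1_alt; nra. }
rewrite pow2_sqrt in e1, e2 by exact hq.
pose proof (hB t (s / 2) x x' n hx hx' ltac:(lra) e1 ltac:(fold N; lra)) as k1.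
pose proof (hB (t + s / 2) (s / 2) x' x n hx' hx ltac:(lra) e2 ltac:(fold N; lra)) as k2.
replace (t + s / 2 + s / 2) with (t + s) in k2 by field.
fold N in k1, k2.
assert (hN : B ^ 2 / N <= 8 * B ^ 2 / w ^ 2 * s).
{ apply (Rmult_le_reg_r N); [lra |].
  replace (B ^ 2 / N * N) with (B ^ 2) by (field; lra).
  replace (8 * B ^ 2 / w ^ 2 * s * N) with (B ^ 2 * (8 * s * N / w ^ 2)) by (field; lra).
  rewrite <- (Rmult_1_r (B ^ 2)) at 1; apply Rmult_le_compat_l; [nra |].
  apply (Rmult_le_reg_r (w ^ 2)); [lra |].
  replace (8 * s * N / w ^ 2 * w ^ 2) with (8 * s * N) by (field; lra).
  rewrite <- hy; nra. }
replace (16 * B ^ 2 / w ^ 2 * s) with (2 * (8 * B ^ 2 / w ^ 2 * s)) by (field; lra).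
lra.
Qed.

Lemma height_lipschitz : exists C, 0 < C /\
  forall t s x, 0 <= x <= w -> 0 <= s ->
    0 <= height (t + s) x - height t x <= C * s.
Proof.
destruct height_lipschitz_local as [C [s1 [hC [hs1 h]]]].
exists C; split; [exact hC |].
assert (hn : forall n t s x, 0 <= x <= w -> 0 <= s <= INR n * s1 ->
  0 <= height (t + s) x - height t x <= C * s).
{ induction n as [|n IH]; intros t s x hx hs.
  - simpl in hs; replace s with 0 by lra; rewrite Rplus_0_r; lra.
  - rewrite S_INR in hs; destruct (Rle_dec s s1) as [hle | hgt].
    + destruct (Req_dec s 0) as [-> | hne]; [rewrite Rplus_0_r; lra |].
      apply h; auto; lra.
    + pose proof (h t s1 x hx ltac:(lra)) as a1.
      pose proof (IH (t + s1) (s - s1) x hx ltac:(lra)) as a2.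
      replace (t + s1 + (s - s1)) with (t + s) in a2 by ring; lra. }
intros t s x hx hs.
destruct (INR_unbounded (s / s1)) as [n hns].
apply (hn n); auto; split; [exact hs |].
apply (Rmult_lt_compat_r s1) in hns; [| exact hs1].
replace (s / s1 * s1) with s in hns by (field; lra); lra.
Qed.

(** [s] is the sagitta of a circle of radius [N] at lateral distance [e], namely
    [N - sqrt (N ^ 2 - e ^ 2)]. *)
Lemma circle_gap N e : 0 <= e <= N -> 0 < N ->
  exists s, 0 <= s /\ e ^ 2 = s * (2 * N - s) /\ s * N <= e ^ 2.
Proof.
intros he hN; set (q := sqrt (N ^ 2 - e ^ 2)).
assert (hq : q ^ 2 = N ^ 2 - e ^ 2) by (unfold q; apply pow2_sqrt; nra).
assert (hq0 : 0 <= q) by apply sqrt_pos.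
exists (N - q); assert (q <= N) by nra; repeat split; nra.
Qed.

(** Along a circle of large integer radius one passes from [x] to [x'] within a time [s] of order
    [1 / N] without losing height; returning in time along [x'] costs at most [C * s]. *)
Lemma height_space_const t x x' : 0 <= x <= w -> 0 <= x' <= w ->
  height t x = height t x'.
Proof.
assert (h : forall x x', 0 <= x <= w -> 0 <= x' <= w -> height t x <= height t x').
{ clear x x'; intros x x' hx hx'.
  destruct height_lipschitz as [C [hC hlip]].
  destruct height_step as [B [hB1 [hBw hB]]].
  cut (height t x - height t x' <= 0); [lra |].
  apply le_of_forall_inv with (C := C * w ^ 2); intros K hK.
  destruct (INR_unbounded (K + B + w ^ 2)) as [n hn].
  assert (hN : 0 < INR n + 2) by (pose proof (pos_INR n); lra).
  destruct (@circle_gap (INR n + 2) (Rabs (x' - x))) as [s [hs0 [hs1 hs2]]].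
  { split; [apply Rabs_pos |]; apply Rabs_le; nra. }
  { exact hN. }
  rewrite pow2_abs in hs1, hs2.
  assert (hs3 : s * (INR n + 2) <= w ^ 2) by nra.
  assert (s <= 1) by nra.
  pose proof (hB t s x x' n hx hx' ltac:(lra) hs1 ltac:(nra)).
  pose proof (hlip t s x' hx' hs0).
  assert (s <= w ^ 2 / K).
  { apply (Rmult_le_reg_r K); [exact hK |].
    replace (w ^ 2 / K * K) with (w ^ 2) by (field; lra); nra. }
  replace (C * w ^ 2 / K) with (C * (w ^ 2 / K)) by (unfold Rdiv; ring).
  nra. }
intros; apply Rle_antisym; apply h; auto.
Qed.


(** * Height as a function of time alone, and continuity of the separation *)

Definition H (t : R) : R := height t 0.

Lemma height_H t x : 0 <= x <= w -> height t x = H t.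
Proof. intro hx; apply height_space_const; auto. Qed.

Lemma H_shift t : H (t + 1) = H t + 1.
Proof. apply (@height_shift t 0 in_0 1). Qed.

Lemma H_lipschitz : exists C, 0 < C /\
  forall t s, 0 <= s -> 0 <= H (t + s) - H t <= C * s.
Proof.
destruct height_lipschitz as [C [hC h]]; exists C; split; [exact hC |].
intros; now apply h.
Qed.

Lemma sep_eq_H t s x x' n : 0 <= x <= w -> 0 <= x' <= w ->
  (x' - x) ^ 2 = s * (2 * (INR n + 2) - s) ->
  sep t x (t + s) x' ^ 2 =
  (H (t + s) - H t) * (2 * (INR n + 2) - (H (t + s) - H t)).
Proof.
intros hx hx' h.
rewrite <- (height_H t hx), <- (height_H (t + s) hx').
now apply sep_eq_height.
Qed.

(** This is [sep_eq_H] for the shortest length 2, with the height gain bounded by the Lipschitz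
    constant. *)
Lemma sep_diagonal : exists A, 0 < A /\
  forall t s x x', 0 <= x <= w -> 0 <= x' <= w -> 0 <= s ->
    (x' - x) ^ 2 = s * (4 - s) -> sep t x (t + s) x' <= A * sqrt s.
Proof.
destruct H_lipschitz as [C [hC hlip]].
exists (sqrt (4 * C)); split; [apply sqrt_lt_R0; lra |].
intros t s x x' hx hx' hs h.
pose proof (@sep_eq_H t s x x' 0 hx hx' ltac:(simpl; lra)) as e.
simpl INR in e.
rewrite <- sqrt_mult by lra.
rewrite <- (sqrt_pow2 (sep t x (t + s) x')) by apply sep_nonneg.
apply sqrt_le_1_alt; rewrite e; pose proof (hlip t s hs); nra.
Qed.

Lemma sep_time : exists A s1, 0 < A /\ 0 < s1 <= 1 /\
  forall t s x, 0 <= x <= w -> 0 <= s <= s1 -> sep t x (t + s) x <= A * sqrt s.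
Proof.
destruct sep_diagonal as [A [hA h]].
exists (2 * A), (Rmin 1 (w ^ 2 / 8)); split; [lra |].
split; [split; [apply Rmin_glb_lt; nra | apply Rmin_l] |].
intros t s x hx [hs hs1].
assert (s <= 1) by (eapply Rle_trans; [exact hs1 | apply Rmin_l]).
assert (s <= w ^ 2 / 8) by (eapply Rle_trans; [exact hs1 | apply Rmin_r]).
assert (hq : 0 <= s / 2 * (4 - s / 2)) by (apply Rmult_le_pos; lra).
destruct (@opposite_point x (sqrt (s / 2 * (4 - s / 2))) hx) as [x' [hx' [e1 e2]]].
{ split; [apply sqrt_pos |].
  rewrite <- (sqrt_pow2 (w / 2)) by lra; apply sqrt_le_1_alt; nra. }
rewrite pow2_sqrt in e1, e2 by exact hq.
pose proof (h t (s / 2) x x' hx hx' ltac:(lra) e1) as k1.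
pose proof (h (t + s / 2) (s / 2) x' x hx' hx ltac:(lra) e2) as k2.
replace (t + s / 2 + s / 2) with (t + s) in k2 by field.
pose proof (@sep_tri (t + s / 2) x' t x (t + s) x hx hx' hx).
assert (sqrt (s / 2) <= sqrt s) by (apply sqrt_le_1_alt; lra).
nra.
Qed.

(** One moves from [x] to [x'] along a circle of radius 2 and then back in time. The time gap is at
    most the squared lateral distance, so both square-root bounds become linear. *)
Lemma sep_space : exists A e1, 0 < A /\ 0 < e1 /\
  forall t x x', 0 <= x <= w -> 0 <= x' <= w -> Rabs (x' - x) <= e1 ->
    sep t x t x' <= A * Rabs (x' - x).
Proof.
destruct sep_diagonal as [A [hA hdiag]].
destruct sep_time as [A' [s1 [hA' [hs1 htime]]]].
exists (A + A'), s1; split; [lra |]; split; [lra |].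
intros t x x' hx hx' he.
destruct (@circle_gap 2 (Rabs (x' - x))) as [s [hs0 [hs h2]]];
  [pose proof (Rabs_pos (x' - x)); lra | lra |].
pose proof (Rabs_pos (x' - x)).
assert (s <= s1) by nra.
rewrite pow2_abs in hs.
pose proof (hdiag t s x x' hx hx' hs0 ltac:(lra)) as k1.
pose proof (htime t s x' hx' ltac:(lra)) as k2.
pose proof (@sep_tri (t + s) x' t x t x' hx hx' hx') as k3.
rewrite (@sep_sym (t + s) x' t x' hx' hx') in k3.
assert (sqrt s <= Rabs (x' - x)).
{ rewrite <- (sqrt_pow2 (Rabs (x' - x))) by assumption.
  apply sqrt_le_1_alt; lra. }
nra.
Qed.

Lemma sqrt_facts s : 0 < s <= 1 ->
  0 < sqrt s /\ sqrt s * sqrt s = s /\ s <= sqrt s.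
Proof.
intro hs; assert (h : 0 < sqrt s) by (apply sqrt_lt_R0; lra).
pose proof (sqrt_sqrt s ltac:(lra)); repeat split; auto.
assert (sqrt s <= 1) by (rewrite <- sqrt_1; apply sqrt_le_1_alt; lra); nra.
Qed.

(* A step of length [s] in time is compared, through a segment of integer length
   about [(x' - x)^2 / (2 s)], with the cross-section at any time of the step. *)
Lemma H_increment x x' : 0 <= x -> x < x' -> x' <= w ->
  exists K s1, 0 < K /\ 0 < s1 <= 1 /\
    forall t s tau, 0 < s <= s1 -> t <= tau <= t + s ->
      Rabs (H (t + s) - H t - s * (sep tau x tau x' ^ 2 / (x' - x) ^ 2)) <=
      K * s * sqrt s.
Proof.
intros hx hxx' hx'.
destruct H_lipschitz as [C [hC hlip]].
destruct unit_step_bounded as [B [hB1 [hBw hB]]].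
destruct sep_time as [A [s1 [hA [hs1 htime]]]].
destruct sep_space as [A' [e1 [hA' [he1 hspace]]]].
set (om := x' - x); assert (hom : 0 < om) by (unfold om; lra).
set (A3 := 2 * A + A' * 3 / om).
assert (hA3 : 0 < A3).
{ unfold A3; assert (0 < A' * 3 / om) by (apply Rdiv_lt_0_compat; lra); lra. }
exists ((2 * C + 2 * B * A3 + C ^ 2) / om ^ 2),
  (Rmin s1 (Rmin (om ^ 2 / 4) (e1 * om / 3))).
split; [apply Rdiv_lt_0_compat; nra |].
split.
{ split; [| eapply Rle_trans; [apply Rmin_l | lra]].
  repeat apply Rmin_glb_lt; nra. }
intros t s tau [hs hs'] htau.
assert (g1 : s <= s1) by (eapply Rle_trans; [exact hs' | apply Rmin_l]).
assert (g2 : s <= om ^ 2 / 4).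
{ eapply Rle_trans; [exact hs' |]; eapply Rle_trans; [apply Rmin_r | apply Rmin_l]. }
assert (g3 : s <= e1 * om / 3).
{ eapply Rle_trans; [exact hs' |]; eapply Rle_trans; [apply Rmin_r | apply Rmin_r]. }
destruct (@sqrt_facts s ltac:(lra)) as [r0 [r1 r2]].
(* Rounding down to [N] leaves [2 * N * s] within [2 * s] of [om ^ 2]. The exact segment then ends
   at lateral distance [de], which misses [om] by at most [3 * s / om]. *)
set (y := om ^ 2 / (2 * s)).
assert (hy : y * (2 * s) = om ^ 2) by (unfold y; field; lra).
destruct (@nat_floor_from_two y) as [n [hn1 hn2]].
{ apply (Rmult_le_reg_r (2 * s)); lra. }
assert (hn3 : y < INR n + 2 + 1) by lra; pose proof (pos_INR n).
assert (hN2 : 2 <= INR n + 2) by lra.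
set (N := INR n + 2) in *.
assert (hN : om ^ 2 - 2 * s <= 2 * N * s <= om ^ 2) by nra.
set (de := sqrt (s * (2 * N - s))).
assert (hde : de ^ 2 = s * (2 * N - s)) by (unfold de; apply pow2_sqrt; nra).
assert (hde0 : 0 <= de) by apply sqrt_pos.
assert (hde1 : de <= om) by nra.
assert (hde2 : om - de <= 3 * s / om).
{ apply (Rmult_le_reg_r om); [exact hom |].
  replace (3 * s / om * om) with (3 * s) by (field; lra). nra. }
assert (he : 3 * s / om <= e1).
{ apply (Rmult_le_reg_r om); [exact hom |].
  replace (3 * s / om * om) with (3 * s) by (field; lra). lra. }
assert (hxi : 0 <= x <= w) by lra.
assert (hx'i : 0 <= x' <= w) by lra.
assert (hyi : 0 <= x + de <= w) by (unfold om in *; lra).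
pose proof (@sep_eq_H t s x (x + de) n hxi hyi ltac:(fold N; rewrite <- hde; ring)) as e.
fold N in e.
pose proof (hlip t s ltac:(lra)) as hk.
set (k := H (t + s) - H t) in *.
set (D1 := sep t x (t + s) (x + de)) in *.
set (D0 := sep tau x tau x').
assert (b0 : 0 <= D0 <= B).
{ split; [apply sep_nonneg |].
  destruct (hB tau 0 x x' hxi hx'i ltac:(lra)) as [b _].
  rewrite Rplus_0_r in b; exact b. }
assert (b1 : 0 <= D1 <= B).
{ split; [apply sep_nonneg |]; apply (hB t s x (x + de) hxi hyi); lra. }
assert (c1 : sep t x tau x <= A * sqrt s).
{ pose proof (htime t (tau - t) x hxi ltac:(lra)) as c.
  replace (t + (tau - t)) with tau in c by ring.
  assert (sqrt (tau - t) <= sqrt s) by (apply sqrt_le_1_alt; lra); nra. }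
assert (c2 : sep tau (x + de) (t + s) (x + de) <= A * sqrt s).
{ pose proof (htime tau (t + s - tau) (x + de) hyi ltac:(lra)) as c.
  replace (tau + (t + s - tau)) with (t + s) in c by ring.
  assert (sqrt (t + s - tau) <= sqrt s) by (apply sqrt_le_1_alt; lra); nra. }
assert (c3 : sep tau (x + de) tau x' <= A' * 3 / om * sqrt s).
{ assert (ha : Rabs (x' - (x + de)) = om - de)
    by (rewrite Rabs_right; unfold om in *; lra).
  pose proof (hspace tau (x + de) x' hyi hx'i ltac:(rewrite ha; lra)) as c.
  rewrite ha in c.
  replace (A' * 3 / om * sqrt s) with (A' * (3 * sqrt s / om)) by (field; lra).
  eapply Rle_trans; [exact c |]; apply Rmult_le_compat_l; [lra |].
  eapply Rle_trans; [exact hde2 |].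
  apply Rmult_le_compat_r; [left; now apply Rinv_0_lt_compat | lra]. }
assert (hD : Rabs (D1 - D0) <= A3 * sqrt s).
{ pose proof (@sep_tri tau x t x (t + s) (x + de) hxi hxi hyi).
  pose proof (@sep_tri tau (x + de) tau x (t + s) (x + de) hxi hyi hyi).
  pose proof (@sep_tri tau x' tau x tau (x + de) hxi hx'i hyi).
  pose proof (@sep_tri t x tau x tau x' hxi hxi hx'i).
  pose proof (@sep_tri (t + s) (x + de) t x tau x' hxi hyi hx'i).
  pose proof (@sep_tri tau (x + de) (t + s) (x + de) tau x' hyi hyi hx'i).
  rewrite (@sep_sym tau x t x hxi hxi) in *.
  rewrite (@sep_sym tau x' tau (x + de) hx'i hyi) in *.
  rewrite (@sep_sym (t + s) (x + de) tau (x + de) hyi hyi) in *.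
  unfold A3, D1, D0; apply Rabs_le; split; lra. }
assert (hD2 : Rabs (D1 ^ 2 - D0 ^ 2) <= 2 * B * A3 * sqrt s).
{ replace (D1 ^ 2 - D0 ^ 2) with ((D1 - D0) * (D1 + D0)) by ring.
  rewrite Rabs_mult, (Rabs_right (D1 + D0)) by lra.
  pose proof (Rabs_pos (D1 - D0)); nra. }
(* Since [2 * N * k = D1 ^ 2 + k ^ 2], the error splits into the rounding of [N], the change of
   cross-section, and the quadratic term in [k]. *)
replace (k - s * (D0 ^ 2 / om ^ 2))
  with ((k * (om ^ 2 - 2 * N * s) + s * (D1 ^ 2 - D0 ^ 2) + s * k ^ 2) / om ^ 2)
  by (rewrite e; field; lra).
replace ((2 * C + 2 * B * A3 + C ^ 2) / om ^ 2 * s * sqrt s)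
  with ((2 * C * s * sqrt s + s * (2 * B * A3 * sqrt s) + s * (C ^ 2 * sqrt s)) / om ^ 2)
  by (field; lra).
unfold Rdiv; rewrite Rabs_mult, (Rabs_right (/ om ^ 2))
  by (apply Rle_ge; left; apply Rinv_0_lt_compat; nra).
apply Rmult_le_compat_r; [left; apply Rinv_0_lt_compat; nra |].
eapply Rle_trans; [apply Rabs_triang |]; apply Rplus_le_compat.
- eapply Rle_trans; [apply Rabs_triang |]; apply Rplus_le_compat.
  + rewrite Rabs_right; nra.
  + rewrite Rabs_mult, (Rabs_right s) by lra; apply Rmult_le_compat_l; lra.
- rewrite Rabs_right by nra; apply Rmult_le_compat_l; [lra |].
  assert (k ^ 2 <= (C * s) ^ 2) by (apply pow_incr; lra).
  assert (s ^ 2 <= sqrt s) by nra.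
  nra.
Qed.

(** * The derivative of the height and its constancy *)

Definition slope (t : R) : R := sep t 0 t w ^ 2 / w ^ 2.

Lemma slope_increment : exists K s1, 0 < K /\ 0 < s1 <= 1 /\
  forall t s tau, 0 < s <= s1 -> t <= tau <= t + s ->
    Rabs (H (t + s) - H t - s * slope tau) <= K * s * sqrt s.
Proof.
destruct (@H_increment 0 w ltac:(lra) hw ltac:(lra)) as [K [s1 h]].
rewrite Rminus_0_r in h; now exists K, s1.
Qed.

(** The increment of [H] does not involve [x] and [x'], so the quotients for [x, x'] and for [0, w]
    are both its limiting rate. Time steps [r ^ 2] turn the square-root error into [r]. *)
Lemma sep_slope t x x' : 0 <= x -> x < x' -> x' <= w ->
  sep t x t x' ^ 2 = slope t * (x' - x) ^ 2.
Proof.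
intros hx hxx' hx'.
destruct (H_increment hx hxx' hx') as [K [s1 [hK [hs1 h]]]].
destruct slope_increment as [K' [s1' [hK' [hs1' h']]]].
set (g := sep t x t x' ^ 2 / (x' - x) ^ 2).
assert (hg : Rabs (g - slope t) <= 0).
{ apply le_of_forall_inv with (C := K + K'); intros L hL.
  set (r := Rmin (1 / L) (Rmin s1 s1')).
  assert (hr : 0 < r).
  { unfold r; repeat apply Rmin_glb_lt; try lra; apply Rdiv_lt_0_compat; lra. }
  assert (r1 : r <= 1 / L) by apply Rmin_l.
  assert (r2 : r <= s1) by (eapply Rle_trans; [apply Rmin_r | apply Rmin_l]).
  assert (r3 : r <= s1') by (eapply Rle_trans; [apply Rmin_r | apply Rmin_r]).
  assert (hs : 0 < r ^ 2 <= r) by nra.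
  pose proof (h t (r ^ 2) t ltac:(lra) ltac:(lra)) as a1; fold g in a1.
  pose proof (h' t (r ^ 2) t ltac:(lra) ltac:(lra)) as a2.
  rewrite sqrt_pow2 in a1, a2 by lra.
  assert (a3 : Rabs (r ^ 2 * (g - slope t)) <= (K + K') * r ^ 2 * r).
  { replace (r ^ 2 * (g - slope t))
      with ((H (t + r ^ 2) - H t - r ^ 2 * slope t) -
            (H (t + r ^ 2) - H t - r ^ 2 * g)) by ring.
    eapply Rle_trans; [apply Rabs_triang |]; rewrite Rabs_Ropp; lra. }
  rewrite Rabs_mult, (Rabs_right (r ^ 2)) in a3 by lra.
  assert (a4 : Rabs (g - slope t) <= (K + K') * r)
    by (apply (Rmult_le_reg_l (r ^ 2)); lra).
  eapply Rle_trans; [exact a4 |].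
  replace ((K + K') / L) with ((K + K') * (1 / L)) by (field; lra).
  apply Rmult_le_compat_l; lra. }
pose proof (Rle_abs (g - slope t)); pose proof (Rle_abs (- (g - slope t))).
rewrite Rabs_Ropp in *.
replace (slope t) with g by lra; unfold g; field; lra.
Qed.

Lemma slope_nonneg t : 0 <= slope t.
Proof.
unfold slope, Rdiv; apply Rmult_le_pos; [apply pow2_ge_0 |].
left; apply Rinv_0_lt_compat; nra.
Qed.

Lemma slope_bounded : exists B, 0 < B /\ forall t, slope t <= B.
Proof.
destruct unit_step_bounded as [B [hB1 [hBw hB]]].
exists (B ^ 2 / w ^ 2); split; [apply Rdiv_lt_0_compat; nra |]; intro t.
unfold slope, Rdiv; apply Rmult_le_compat_r.
- left; apply Rinv_0_lt_compat; nra.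
- apply pow_incr; split; [apply sep_nonneg |].
  destruct (hB t 0 0 w in_0 ltac:(lra) ltac:(lra)) as [h _].
  rewrite Rplus_0_r in h; exact h.
Qed.

Lemma H_derivative t : derivable_pt_lim H t (slope t).
Proof.
destruct slope_increment as [K [s1 [hK [hs1 h]]]].
intros eps heps.
set (q := eps / (2 * K)).
assert (hq : K * q = eps / 2) by (unfold q; field; lra).
assert (hq0 : 0 < q) by (apply Rdiv_lt_0_compat; lra).
assert (hdel : 0 < Rmin s1 (q ^ 2)) by (apply Rmin_glb_lt; nra).
exists (mkposreal _ hdel); intros u hu0 hu; simpl in hu.
assert (h1 : Rabs u < s1) by (eapply Rlt_le_trans; [exact hu | apply Rmin_l]).
assert (h2 : Rabs u < q ^ 2) by (eapply Rlt_le_trans; [exact hu | apply Rmin_r]).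
assert (hup : 0 < Rabs u) by now apply Rabs_pos_lt.
assert (hsq : sqrt (Rabs u) <= q).
{ rewrite <- (sqrt_pow2 q) by lra; apply sqrt_le_1_alt; lra. }
assert (hmain : Rabs (H (t + u) - H t - u * slope t) <= K * Rabs u * sqrt (Rabs u)).
(* For negative [u] the step starts at [t + u] and the cross-section is taken at its right end [t];
   the freedom in [tau] serves here. *)
{ destruct (Rle_dec 0 u) as [hu1 | hu1].
  - rewrite (Rabs_right u) in * by lra; apply h; lra.
  - rewrite (Rabs_left u) in * by lra.
    pose proof (h (t + u) (- u) t ltac:(lra) ltac:(lra)) as e.
    replace (t + u + - u) with t in e by ring.
    replace (H (t + u) - H t - u * slope t)
      with (- (H t - H (t + u) - - u * slope t)) by ring.
    rewrite Rabs_Ropp; exact e. }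
replace ((H (t + u) - H t) / u - slope t)
  with ((H (t + u) - H t - u * slope t) / u) by (field; auto).
unfold Rdiv; rewrite Rabs_mult, Rabs_inv.
apply (Rmult_lt_reg_r (Rabs u)); [exact hup |].
rewrite Rmult_assoc, Rinv_l, Rmult_1_r by lra.
assert (K * Rabs u * sqrt (Rabs u) <= K * Rabs u * q)
  by (apply Rmult_le_compat_l; nra).
replace (K * Rabs u * q) with (Rabs u * (eps / 2)) in * by (rewrite <- hq; ring).
nra.
Qed.

(* The two segments from [(t, w/2)] to [(t + s, w/2 -+ e)] have equal integer
   length, and [2 e] is at most of the order of [w]; the triangle inequality for
   the widths bounds the cross-section at [t + s] by the increment of [H]. *)
Lemma H_increment_lower : exists K s1, 0 < K /\ 0 < s1 /\
  forall t s, 0 < s <= s1 -> s * slope (t + s) - K * s ^ 3 <= H (t + s) - H t.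
Proof.
destruct slope_bounded as [B [hB0 hB]].
assert (hw2 : 0 < w ^ 2) by nra.
exists (16 * B / w ^ 2), (Rmin 1 (w ^ 2 / 16)).
split; [apply Rdiv_lt_0_compat; lra |].
split; [apply Rmin_glb_lt; lra |].
intros t s [hs hs'].
assert (g1 : s <= 1) by (eapply Rle_trans; [exact hs' | apply Rmin_l]).
assert (g2 : s <= w ^ 2 / 16) by (eapply Rle_trans; [exact hs' | apply Rmin_r]).
(* This keeps [e <= w / 2], while [N] is at least [w ^ 2 / (16 * s)], so that the error
   [f * s ^ 2 / (2 * N)] is cubic in [s]. *)
set (y := w ^ 2 / (8 * s)).
assert (hy : y * (8 * s) = w ^ 2) by (unfold y; field; lra).
destruct (@nat_floor_from_two y) as [n [hn1 hn2]].
{ apply (Rmult_le_reg_r (8 * s)); lra. }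
assert (hn3 : y < INR n + 2 + 1) by lra; pose proof (pos_INR n).
assert (hN2 : 2 <= INR n + 2) by lra.
set (N := INR n + 2) in *.
assert (hN : w ^ 2 <= 16 * s * N) by nra.
set (e := sqrt (s * (2 * N - s))).
assert (he : e ^ 2 = s * (2 * N - s)) by (unfold e; apply pow2_sqrt; nra).
assert (he0 : 0 < e) by (apply sqrt_lt_R0; nra).
assert (he1 : e <= w / 2) by nra.
assert (c0 : 0 <= w / 2 <= w) by lra.
assert (c1 : 0 <= w / 2 - e <= w) by lra.
assert (c2 : 0 <= w / 2 + e <= w) by lra.
pose proof (@sep_eq_H t s (w / 2) (w / 2 - e) n c0 c1
  ltac:(fold N; rewrite <- he; ring)) as e1.
pose proof (@sep_eq_H t s (w / 2) (w / 2 + e) n c0 c2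
  ltac:(fold N; rewrite <- he; ring)) as e2.
fold N in e1, e2.
pose proof (@sep_tri t (w / 2) (t + s) (w / 2 - e) (t + s) (w / 2 + e) c1 c0 c2) as h3.
rewrite (@sep_sym (t + s) (w / 2 - e) t (w / 2)) in h3 by auto.
pose proof (@sep_slope (t + s) (w / 2 - e) (w / 2 + e) ltac:(lra) ltac:(lra) ltac:(lra)) as h4.
pose proof (sep_nonneg (t + s) (w / 2 - e) (t + s) (w / 2 + e)) as p0.
pose proof (sep_nonneg t (w / 2) (t + s) (w / 2 - e)) as p1.
pose proof (sep_nonneg t (w / 2) (t + s) (w / 2 + e)) as p2.
set (k := H (t + s) - H t) in *.
set (D0 := sep (t + s) (w / 2 - e) (t + s) (w / 2 + e)) in *.
set (D1 := sep t (w / 2) (t + s) (w / 2 - e)) in *.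
set (D2 := sep t (w / 2) (t + s) (w / 2 + e)) in *.
assert (h5 : D0 ^ 2 <= (D1 + D2) ^ 2) by (apply pow_incr; lra).
assert (h6 : (D1 + D2) ^ 2 <= 4 * (k * (2 * N - k)))
  by (pose proof (pow2_ge_0 (D1 - D2)); nra).
pose proof (slope_nonneg (t + s)) as f0; pose proof (hB (t + s)) as f1.
set (f := slope (t + s)) in *.
replace ((w / 2 + e - (w / 2 - e)) ^ 2) with (4 * e ^ 2) in h4 by ring.
rewrite he in h4.
assert (h7 : f * s * (2 * N - s) <= 2 * N * k) by nra.
apply (Rmult_le_reg_l (2 * N)); [lra |].
assert (h8 : f * s ^ 2 <= 2 * N * (16 * B / w ^ 2 * s ^ 3)).
{ replace (2 * N * (16 * B / w ^ 2 * s ^ 3))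
    with (2 * B * s ^ 2 * (16 * s * N / w ^ 2)) by (field; lra).
  assert (1 <= 16 * s * N / w ^ 2).
  { apply (Rmult_le_reg_r (w ^ 2)); [exact hw2 |].
    replace (16 * s * N / w ^ 2 * w ^ 2) with (16 * s * N) by (field; lra). lra. }
  assert (0 < s ^ 2) by nra.
  assert (f * s ^ 2 <= B * s ^ 2) by nra.
  assert (0 < B * s ^ 2) by nra.
  nra. }
nra.
Qed.

(* [(H (t + s) - H t) / s - K s^2] is decreasing in [s], with limit [slope t] at 0. *)
Lemma H_increment_upper : exists K s1, 0 < K /\ 0 < s1 /\
  forall t s, 0 < s <= s1 -> H (t + s) - H t <= s * slope t + K * s ^ 3.
Proof.
destruct H_increment_lower as [K [s1 [hK [hs1 h]]]].
destruct slope_increment as [K' [s1' [hK' [hs1' h']]]].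
exists K, s1; split; [exact hK |]; split; [exact hs1 |]; intros t s hs.
set (v := fun u => (H (t + u) - H t) / u - K * u ^ 2).
assert (hdec : forall r, 0 < r < s -> v s <= v r).
{ intros r hr.
  destruct (@MVT_cor2 v (fun u => (slope (t + u) * u - (H (t + u) - H t)) / u ^ 2 -
    2 * K * u) r s ltac:(lra)) as [c [hc1 hc2]].
  - intros c hc; unfold v.
    apply (derivable_pt_lim_minus (fun u => (H (t + u) - H t) / u) (fun u => K * u ^ 2)).
    + replace ((slope (t + c) * c - (H (t + c) - H t)) / c ^ 2)
        with ((slope (t + c) * c - 1 * (H (t + c) - H t)) / Rsqr c)
        by (unfold Rsqr; field; lra).
      apply (derivable_pt_lim_div (fun u => H (t + u) - H t) id).
      * rewrite <- (Rminus_0_r (slope (t + c))).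
        apply (derivable_pt_lim_minus (fun u => H (t + u)) (fun _ => H t));
          [| apply derivable_pt_lim_const].
        rewrite <- (Rmult_1_r (slope (t + c))), <- (Rplus_0_l 1).
        apply (derivable_pt_lim_comp (fun u => t + u) H);
          [| apply H_derivative].
        apply (derivable_pt_lim_plus (fun _ => t) id);
          [apply derivable_pt_lim_const | apply derivable_pt_lim_id].
      * apply derivable_pt_lim_id.
      * unfold id; lra.
    + replace (2 * K * c) with (K * (INR 2 * c ^ 1)) by (simpl; ring).
      apply (derivable_pt_lim_scal (fun u => u ^ 2)).
      apply derivable_pt_lim_pow.
  (* The lower bound makes the quotient term at most [K * c], less than the subtracted [2 * K * c],
     so the derivative of [v] is negative. *)
  - pose proof (h t c ltac:(lra)) as e.
    assert ((slope (t + c) * c - (H (t + c) - H t)) / c ^ 2 <= K * c).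
    { apply (Rmult_le_reg_r (c ^ 2)); [nra |].
      replace ((slope (t + c) * c - (H (t + c) - H t)) / c ^ 2 * c ^ 2)
        with (slope (t + c) * c - (H (t + c) - H t)) by (field; lra).
      nra. }
    assert (0 < K * c) by nra.
    nra. }
assert (hlim : v s - slope t <= 0).
{ apply le_of_forall_inv with (C := K'); intros L hL.
  set (r := Rmin (1 / L) (Rmin (sqrt (s / 2)) s1')).
  assert (hss : 0 < sqrt (s / 2)) by (apply sqrt_lt_R0; lra).
  assert (hr : 0 < r).
  { unfold r; repeat apply Rmin_glb_lt; try lra; apply Rdiv_lt_0_compat; lra. }
  assert (r1 : r <= 1 / L) by apply Rmin_l.
  assert (r2 : r <= sqrt (s / 2)) by (eapply Rle_trans; [apply Rmin_r | apply Rmin_l]).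
  assert (r3 : r <= s1') by (eapply Rle_trans; [apply Rmin_r | apply Rmin_r]).
  pose proof (sqrt_sqrt (s / 2) ltac:(lra)).
  assert (hr2 : 0 < r ^ 2 <= r) by nra.
  assert (hr3 : r ^ 2 < s) by nra.
  pose proof (hdec (r ^ 2) ltac:(lra)) as e1.
  pose proof (h' t (r ^ 2) t ltac:(lra) ltac:(lra)) as e2.
  rewrite sqrt_pow2 in e2 by lra.
  pose proof (Rle_trans _ _ _ (Rle_abs _) e2) as e3.
  assert (e4 : (H (t + r ^ 2) - H t) / r ^ 2 <= slope t + K' * r).
  { apply (Rmult_le_reg_r (r ^ 2)); [lra |].
    replace ((H (t + r ^ 2) - H t) / r ^ 2 * r ^ 2) with (H (t + r ^ 2) - H t)
      by (field; lra).
    lra. }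
  assert (0 <= K * (r ^ 2) ^ 2) by (apply Rmult_le_pos; [lra | apply pow2_ge_0]).
  assert (K' * r <= K' / L).
  { replace (K' / L) with (K' * (1 / L)) by (field; lra).
    apply Rmult_le_compat_l; lra. }
  unfold v at 2 in e1; lra. }
unfold v in hlim.
assert (e : (H (t + s) - H t) / s <= slope t + K * s ^ 2) by lra.
apply (Rmult_le_compat_r s) in e; [| lra].
replace ((H (t + s) - H t) / s * s) with (H (t + s) - H t) in e by (field; lra).
lra.
Qed.

Lemma slope_increment_quadratic : exists K s1, 0 < K /\ 0 < s1 /\
  forall t s, 0 < s <= s1 -> slope (t + s) <= slope t + K * s ^ 2.
Proof.
destruct H_increment_lower as [K [s1 [hK [hs1 h]]]].
destruct H_increment_upper as [K' [s1' [hK' [hs1' h']]]].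
exists (K + K'), (Rmin s1 s1'); split; [lra |].
split; [now apply Rmin_glb_lt |]; intros t s [hs hs'].
assert (s <= s1) by (eapply Rle_trans; [exact hs' | apply Rmin_l]).
assert (s <= s1') by (eapply Rle_trans; [exact hs' | apply Rmin_r]).
pose proof (h t s ltac:(lra)); pose proof (h' t s ltac:(lra)).
apply (Rmult_le_reg_l s); lra.
Qed.

(** Over [n] equal steps the quadratic errors add up to [K * u ^ 2 / n], which tends to 0. *)
Lemma slope_decreasing t u : 0 <= u -> slope (t + u) <= slope t.
Proof.
intro hu; destruct slope_increment_quadratic as [K [s1 [hK [hs1 h]]]].
destruct (Req_dec u 0) as [-> | hne]; [rewrite Rplus_0_r; lra |].
cut (slope (t + u) - slope t <= 0); [lra |].
apply le_of_forall_inv with (C := K * u ^ 2); intros L hL.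
destruct (INR_unbounded (L + u / s1)) as [n hn].
assert (hus : 0 < u / s1) by (apply Rdiv_lt_0_compat; lra).
set (s := u / INR n).
assert (hs : s * INR n = u) by (unfold s; field; lra).
assert (hs0 : 0 < s) by (apply Rdiv_lt_0_compat; lra).
assert (hss : s <= s1).
{ apply (Rmult_le_reg_r (INR n)); [lra |]; rewrite hs.
  replace u with (s1 * (u / s1)) by (field; lra); apply Rmult_le_compat_l; lra. }
assert (hi : forall j, slope (t + INR j * s) <= slope t + INR j * (K * s ^ 2)).
{ induction j as [|j IH].
  - simpl; rewrite !Rmult_0_l, !Rplus_0_r; lra.
  - rewrite S_INR; pose proof (h (t + INR j * s) s ltac:(lra)) as e.
    replace (t + (INR j + 1) * s) with (t + INR j * s + s) by ring; lra. }
specialize (hi n); replace (INR n * s) with u in hi by lra.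
replace (INR n * (K * s ^ 2)) with (K * u * s) in hi by (rewrite <- hs; ring).
assert (s <= u / L).
{ apply (Rmult_le_reg_r L); [exact hL |].
  replace (u / L * L) with u by (field; lra); rewrite <- hs; nra. }
replace (K * u ^ 2 / L) with (K * u * (u / L)) by (field; lra).
assert (0 < K * u) by nra; nra.
Qed.

Lemma slope_shift t (n : nat) : slope (t + INR n) = slope t.
Proof.
unfold slope; f_equal; f_equal.
rewrite INR_IZR_INZ; set (z := Z.of_nat n).
pose proof (@sep_shift t 0 in_0 z) as z0.
pose proof (@sep_shift t w ltac:(lra) z) as z1.
assert (c0 := in_0); assert (c1 : 0 <= w <= w) by lra.
pose proof (@sep_tri t 0 (t + IZR z) 0 (t + IZR z) w c0 c0 c1).
pose proof (@sep_tri t w t 0 (t + IZR z) w c0 c1 c1).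
pose proof (@sep_tri (t + IZR z) 0 t 0 t w c0 c0 c1).
pose proof (@sep_tri (t + IZR z) w (t + IZR z) 0 t w c0 c1 c1).
rewrite (@sep_sym (t + IZR z) 0 t 0 c0 c0) in *.
rewrite (@sep_sym (t + IZR z) w t w c1 c1) in *.
lra.
Qed.

Lemma slope_const t t' : slope t = slope t'.
Proof.
assert (h : forall t t', slope t <= slope t').
{ clear t t'; intros t t'.
  destruct (INR_unbounded (t' - t)) as [n hn].
  rewrite <- (slope_shift t n).
  replace (t + INR n) with (t' + (t + INR n - t')) by ring.
  apply slope_decreasing; lra. }
apply Rle_antisym; apply h.
Qed.

Lemma H_increment_slope a b : a < b -> H b - H a = slope 0 * (b - a).
Proof.
intro hab; destruct (@MVT_cor2 H slope a b hab) as [c [hc _]].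
- intros; apply H_derivative.
- now rewrite hc, (slope_const c 0).
Qed.

(** The constant is fixed by [H_shift]: the height gains exactly 1 over a unit of time. *)
Lemma slope_one t : slope t = 1.
Proof.
rewrite (slope_const t 0).
pose proof (@H_increment_slope 0 (0 + 1) ltac:(lra)) as h.
rewrite H_shift in h; lra.
Qed.

Lemma H_sub a b : H b - H a = b - a.
Proof.
pose proof (slope_one 0) as h1.
destruct (Rtotal_order a b) as [h | [-> | h]]; [| ring |];
  apply H_increment_slope in h; rewrite h1 in h; lra.
Qed.

(** * Separation is lateral distance, so the strip is Euclidean *)

Lemma sep_cross_section t x x' : 0 <= x <= w -> 0 <= x' <= w ->
  sep t x t x' = Rabs (x' - x).
Proof.
assert (h : forall x x', 0 <= x -> x < x' -> x' <= w -> sep t x t x' = x' - x).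
{ clear x x'; intros x x' h1 h2 h3.
  pose proof (sep_slope t h1 h2 h3) as e; rewrite slope_one, Rmult_1_l in e.
  pose proof (sep_nonneg t x t x'); nra. }
intros hx hx'; destruct (Rtotal_order x x') as [h1 | [-> | h1]].
- rewrite Rabs_right by lra; apply h; lra.
- pose proof (@sep_shift t x' hx' 0) as z; rewrite Rplus_0_r in z.
  rewrite z, Rminus_diag, Rabs_R0; reflexivity.
- rewrite sep_sym, Rabs_left by (auto; lra).
  rewrite h by lra; ring.
Qed.

(* [S (t + s) x] is the midpoint of [S (t + s) (x - e)] and [S (t + s) (x + e)],
   both of which lie at an integer distance from a shift of [S t x]. *)
Lemma sep_same_time_interior x : 0 < x < w ->
  exists s1, 0 < s1 /\ forall t s, 0 <= s <= s1 -> sep t x (t + s) x = 0.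
Proof.
intro hx.
set (r := Rmin x (w - x)).
assert (hr : 0 < r) by (apply Rmin_glb_lt; lra).
assert (hrx : r <= x) by apply Rmin_l; assert (hrw : r <= w - x) by apply Rmin_r.
exists (Rmin 1 (r ^ 2 / 4)); split; [apply Rmin_glb_lt; nra |].
intros t s [hs hs'].
assert (g1 : s <= 1) by (eapply Rle_trans; [exact hs' | apply Rmin_l]).
assert (g2 : s <= r ^ 2 / 4) by (eapply Rle_trans; [exact hs' | apply Rmin_r]).
set (e := sqrt (s * (4 - s))).
assert (he : e ^ 2 = s * (4 - s)) by (unfold e; apply pow2_sqrt; nra).
assert (he0 : 0 <= e) by apply sqrt_pos.
assert (he1 : e <= r) by nra.
assert (c0 : 0 <= x <= w) by lra.
assert (c1 : 0 <= x - e <= w) by lra.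
assert (c2 : 0 <= x + e <= w) by lra.
pose proof (@sep_eq_H t s x (x - e) 0 c0 c1 ltac:(simpl; lra)) as e1.
pose proof (@sep_eq_H t s x (x + e) 0 c0 c2 ltac:(simpl; lra)) as e2.
rewrite H_sub in e1, e2; simpl INR in e1, e2.
replace (t + s - t) with s in e1, e2 by ring.
assert (hd : forall t1 t2 y z, 0 <= y <= w -> 0 <= z <= w ->
  m (S t1 y) (S t2 z) ^ 2 = sep t1 y t2 z ^ 2 + (t2 - t1) ^ 2).
{ intros t1 t2 y z hy hz; rewrite strip_dist_sq, !height_H, H_sub by auto; ring. }
destruct hm as [hpos [_ [_ _]]].
assert (hcross : forall y z, 0 <= y <= w -> 0 <= z <= w ->
  m (S (t + s) y) (S (t + s) z) = Rabs (z - y)).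
{ intros y z hy hz.
  pose proof (hd (t + s) (t + s) y z hy hz) as q.
  rewrite sep_cross_section in q by auto.
  pose proof (hpos (S (t + s) y) (S (t + s) z)); pose proof (Rabs_pos (z - y)).
  nra. }
assert (hmidp : midpoint m (S (t + s) (x - e)) (S (t + s) (x + e)) (S (t + s) x)).
{ split; rewrite !hcross by auto; rewrite !Rabs_right by lra; field. }
(* Both outer separations have square [e ^ 2] and the base has length [2 * e], so CN reads
   [sep ^ 2 + s ^ 2 <= e ^ 2 + s ^ 2 - e ^ 2]. *)
pose proof (@hcn (S t x) _ _ _ hmidp) as q.
rewrite !(hd t), e1, e2, hcross, Rabs_right in q by (auto; lra).
pose proof (sep_nonneg t x (t + s) x).
replace ((x + e - (x - e)) ^ 2) with (4 * e ^ 2) in q by ring.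
nra.
Qed.

(** On interior lines small steps are chained by the triangle inequality; a boundary line is reached
    as a limit, its separation being at most twice its distance to a nearby interior line. *)
Lemma sep_along_line t t' x : 0 <= x <= w -> sep t x t' x = 0.
Proof.
assert (hint : forall t u x, 0 < x < w -> 0 <= u -> sep t x (t + u) x = 0).
{ clear t t' x; intros t u x hx hu.
  destruct (sep_same_time_interior hx) as [s1 [hs1 h]].
  assert (hx' : 0 <= x <= w) by lra.
  destruct (INR_unbounded (u / s1)) as [n hn].
  assert (hus : 0 <= u / s1)
    by (apply Rmult_le_pos; [exact hu | left; now apply Rinv_0_lt_compat]).
  set (s := u / INR n).
  assert (hs : s * INR n = u) by (unfold s; field; lra).
  assert (hs0 : 0 <= s)
    by (apply Rmult_le_pos; [exact hu | left; apply Rinv_0_lt_compat; lra]).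
  assert (hss : s <= s1).
  { apply (Rmult_le_reg_r (INR n)); [lra |]; rewrite hs.
    replace u with (s1 * (u / s1)) by (field; lra); apply Rmult_le_compat_l; lra. }
  assert (hi : forall j, sep t x (t + INR j * s) x = 0).
  { induction j as [|j IH].
    - simpl; rewrite Rmult_0_l; apply (@sep_shift t x hx' 0).
    - rewrite S_INR; replace (t + (INR j + 1) * s) with (t + INR j * s + s) by ring.
      pose proof (@sep_tri (t + INR j * s) x t x (t + INR j * s + s) x hx' hx' hx').
      rewrite IH, h in * by lra.
      pose proof (sep_nonneg t x (t + INR j * s + s) x); lra. }
  specialize (hi n); now replace (INR n * s) with u in hi by lra. }
assert (hord : forall t t' x, 0 <= x <= w -> t <= t' -> sep t x t' x = 0).
{ clear t t' x; intros t t' x hx ht.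
  apply Rle_antisym; [| apply sep_nonneg].
  apply le_of_forall_inv with (C := 2); intros K hK.
  assert (hK1 : 0 < 1 / K) by (apply Rdiv_lt_0_compat; lra).
  assert (hy : exists y, 0 < y < w /\ Rabs (y - x) <= 1 / K).
  { set (r := Rmin (1 / K) (w / 4)).
    assert (0 < r) by (apply Rmin_glb_lt; lra).
    assert (r <= 1 / K) by apply Rmin_l; assert (r <= w / 4) by apply Rmin_r.
    destruct (Rle_dec x (w / 2)).
    - exists (x + r); split; [lra |]; rewrite Rabs_right; lra.
    - exists (x - r); split; [lra |]; rewrite Rabs_left; lra. }
  destruct hy as [y [hy hyx]].
  assert (hy' : 0 <= y <= w) by lra.
  pose proof (@hint t (t' - t) y hy ltac:(lra)) as z.
  replace (t + (t' - t)) with t' in z by ring.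
  pose proof (@sep_tri t y t x t' x hx hy' hx).
  pose proof (@sep_tri t' y t y t' x hy' hy' hx).
  pose proof (sep_cross_section t hx hy') as k1.
  pose proof (sep_cross_section t' hy' hx) as k2.
  rewrite Rabs_minus_sym in k2.
  replace (2 / K) with (1 / K + 1 / K) by (field; lra); lra. }
intro hx; destruct (Rle_dec t t'); [now apply hord |].
rewrite sep_sym by auto; apply hord; auto; lra.
Qed.

Lemma strip_isometric t1 x1 t2 x2 : 0 <= x1 <= w -> 0 <= x2 <= w ->
  m (S t1 x1) (S t2 x2) = dE (t1, x1) (t2, x2).
Proof.
intros h1 h2; unfold dE; simpl fst; simpl snd.
symmetry; apply sqrt_eq_of_sq; [apply hm |].
rewrite strip_dist_sq, !height_H, H_sub by auto.
assert (h : sep t1 x1 t2 x2 = Rabs (x2 - x1)).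
{ pose proof (@sep_tri t1 x2 t1 x1 t2 x2 h1 h2 h2).
  pose proof (@sep_tri t2 x2 t1 x1 t1 x2 h1 h2 h2).
  rewrite (sep_along_line t1 t2 h2), (sep_along_line t2 t1 h2) in *.
  rewrite sep_cross_section in * by auto; lra. }
rewrite h, pow2_abs; ring.
Qed.

End Strip.

(** * Return to the two metrics *)

Lemma strip_isometry_transfer (X : Type) (d d' : X -> X -> R) (w : R) (f : R * R -> X) :
  CAT0 d -> CAT0 d' -> (forall x y, d x y <= 1 <-> d' x y <= 1) -> 0 < w ->
  (forall p q, 0 <= snd p <= w -> 0 <= snd q <= w -> d (f p) (f q) = dE p q) ->
  forall p q, 0 <= snd p <= w -> 0 <= snd q <= w -> d' (f p) (f q) = dE p q.
Proof.
intros hd hd' hball hw hf [t1 x1] [t2 x2] h1 h2.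
apply (@strip_isometric X d' (fun t x => f (t, x)) w (proj1 hd')
  (CAT0_cn hd') (CAT0_has_midpoints hd') hw); auto.
- intros u1 y1 u2 y2 n i1 i2 h.
  apply (le_nat_transfer hd hd'); [intros; now apply hball |].
  rewrite hf by auto; unfold dE; simpl fst; simpl snd; pose proof (pos_INR n).
  rewrite <- (sqrt_pow2 (INR n + 1)) by lra; now apply sqrt_le_1_alt.
- intros u1 y1 u2 y2 n i1 i2 h.
  apply (eq_nat_transfer hd hd' hball).
  rewrite hf by auto; unfold dE; simpl fst; simpl snd; pose proof (pos_INR n).
  apply sqrt_eq_of_sq; [lra | exact h].
Qed.

Theorem theorem4 (X : Type) (d d' : X -> X -> R) :
  CAT0 d -> locally_compact d -> geodesically_complete d -> connected_at_infinity d ->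
  CAT0 d' -> locally_compact d' -> geodesically_complete d' ->
  (forall x y, d x y <= 1 <-> d' x y <= 1) ->
  forall c : R -> X, complete_geodesic d c -> bounds_flat_strip d c ->
    complete_geodesic d' c /\ bounds_flat_strip d' c /\
    (forall t1 t2, d' (c t1) (c t2) = d (c t1) (c t2)).
Proof.
intros hd _ _ _ hd' _ _ hball c hc [w [f [hw [hf hb]]]].
pose proof (strip_isometry_transfer f hd hd' hball hw hf) as hf'.
assert (heq : forall t1 t2, d' (c t1) (c t2) = d (c t1) (c t2)).
(* Only the image of [c] is known to be a boundary line, not how [c] parametrizes it; it suffices
   that its points lie in the strip, where both metrics agree. *)
{ assert (hcf : exists x, 0 <= x <= w /\ forall t, exists s, f (s, x) = c t).
  { destruct hb as [hb | hb]; [exists 0 | exists w]; (split; [lra |]);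
      intro t; apply hb; now exists t. }
  destruct hcf as [x [hx hcf]]; intros t1 t2.
  destruct (hcf t1) as [s1 <-]; destruct (hcf t2) as [s2 <-].
  now rewrite hf, hf'. }
split; [| split; [| exact heq]].
- intros s t; rewrite heq; apply hc.
- now exists w, f.
Qed.
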